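(* Let $G$ be a connected real Lie group with Lie algebra $\mathfrak{g}$ of right invariant vector fields. Let $\mathcal{X}_0=\mathcal{X},\mathcal{X}_1,\ldots,\mathcal{X}_m$ be linear vector fields on $G$ with $[\mathcal{X}_i,\mathcal{X}_j]=0$ for all $i,j$, whose associated derivations are inner, and let $X_0=X,X_1,\ldots,X_m\in\mathfrak{g}$ satisfy $\mathcal{X}_i=X_i+dI X_i$ and $[X_i,X_j]=0$ for all $i,j=0,\ldots,m$. Let $Y,Y_1,\ldots,Y_m\in\mathfrak{g}$ and consider the affine system $$\Sigma_A:\ \frac{dg}{dt}=(\mathcal{X}+Y)(g)+\sum_{j=1}^{m}u_j(\mathcal{X}_j+Y_j)(g)$$ and the right invariant system $$\Sigma_I:\ \frac{dg}{dt}=(X+Y)(g)+\sum_{j=1}^{m}u_j(X_j+Y_j)(g).$$ Assume that the admissible controls are the piecewise constant functions with values in $U\subset\mathbb{R}^m$, and that $\Sigma_I$ is controllable. Then the following assertions are equivalent: (i) for every (constant) control $u=(u_1,\ldots,u_m)\in U$ and every $t\in\mathbb{R}$, $\exp\left(t\left(X_0+\sum_{i=1}^m u_iX_i\right)\right)\in\mathcal{A}$; (ii) $\Sigma_A$ is controllable.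
   Context: A vector field on $G$ is called linear if its flow is a one-parameter group of automorphisms of $G$. A linear vector field $\mathcal{X}_i$ has associated derivation $\mathcal{D}_i(Z)=-[\mathcal{X}_i,Z]$ of $\mathfrak{g}$. Let $I(g)=g^{-1}$; $dI X_i$ denotes the left invariant vector field $I_*X_i$ induced by $X_i$. The relation $\mathcal{X}_i=X_i+dI X_i$ is equivalent to the flow of $\mathcal{X}_i$ being $g\mapsto\exp(tX_i)\,g\,\exp(-tX_i)$. For a control system, the reachable set from $g$ at time $t>0$ is the set of endpoints at time $t$ of solutions starting at $g$ under admissible controls; for $\Sigma_A$ it is denoted $\mathcal{A}_t(g)$, and $\mathcal{A}(g)=\bigcup_{t>0}\mathcal{A}_t(g)$. Write $\mathcal{A}=\mathcal{A}(e)$, $e$ being the identity of $G$. A system is controllable if the reachable set from every point of $G$ is all of $G$. *)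

(* Defs.v *)
From HB Require Import structures.
From mathcomp Require Import all_boot all_order all_algebra.
From mathcomp Require Import all_classical all_reals all_analysis.

Set Implicit Arguments.
Unset Strict Implicit.
Unset Printing Implicit Defensive.

Import Order.TTheory GRing.Theory Num.Theory.
Import numFieldNormedType.Exports.

Local Open Scope classical_set_scope.
Local Open Scope ring_scope.

(* Meaningful for open [A] only; directional derivatives of all orders exist,
   are differentiable, hence continuous, on [A]. *)
Fixpoint Ck_on (R : realType) (a b k : nat) (A : set 'rV[R]_a)
    (f : 'rV[R]_a -> 'rV[R]_b) : Prop :=
  match k with
  | 0%N => forall x, A x -> {for x, continuous f}
  | k'.+1 => (forall x, A x -> differentiable f x) /\
             (forall v, Ck_on k' A (fun x => 'd f x v))
  end.

Definition smooth_on (R : realType) (a b : nat) (A : set 'rV[R]_a)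
    (f : 'rV[R]_a -> 'rV[R]_b) : Prop := forall k, Ck_on k A f.

(* The atlas is indexed by the points: [chart p] is a chart around [p], with
   domain [chart_dom p] and inverse [chartV p] on the image of that domain.
   Every smooth structure has such an atlas (choose a chart around each
   point); outside their domains, [chart p] and [chartV p] are arbitrary. *)
HB.mixin Record isSmoothManifold (R : realType) (n : nat) M
    of Topological M := {
  chart_dom : M -> set M;
  chart : M -> M -> 'rV[R]_n;
  chartV : M -> 'rV[R]_n -> M;
  chart_dom_open : forall p, open (chart_dom p);
  chart_dom_center : forall p, chart_dom p p;
  chart_image_open : forall p, open (chart p @` chart_dom p);
  chartK : forall p q, chart_dom p q -> chartV p (chart p q) = q;
  chart_continuous : forall p q, chart_dom p q ->
    {for q, continuous (chart p)};
  chartV_continuous : forall p x, (chart p @` chart_dom p) x ->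
    {for x, continuous (chartV p)};
  chart_transition : forall p q,
    smooth_on (chart p @` (chart_dom p `&` chart_dom q)) (chart q \o chartV p);
  manifold_hausdorff : hausdorff_space M;
  manifold_second_countable : @second_countable M
}.

#[short(type="smoothManifoldType")]
HB.structure Definition SmoothManifold (R : realType) (n : nat) :=
  {M of isSmoothManifold R n M & Topological M}.

Definition smooth_map (R : realType) (n : nat) (M : smoothManifoldType R n)
    (f : M -> M) : Prop :=
  continuous f /\
  forall p q : M,
    smooth_on (chart p @` (chart_dom p `&` f @^-1` chart_dom q))
      (chart q \o f \o chartV p).

(* The charts of [M * M] are the [row_mx (chart p _) (chart q _)]. *)
Definition smooth_map2 (R : realType) (n : nat) (M : smoothManifoldType R n)
    (f : M -> M -> M) : Prop :=
  continuous (fun z : M * M => f z.1 z.2) /\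
  forall p q r : M,
    smooth_on
      [set row_mx (chart p z.1) (chart q z.2) | z in
        [set z : M * M | [/\ chart_dom p z.1, chart_dom q z.2
                           & chart_dom r (f z.1 z.2)]]]
      (fun x : 'rV[R]_(n + n) =>
         chart r (f (chartV p (lsubmx x)) (chartV q (rsubmx x)))).

HB.mixin Record isLieGroup (R : realType) (n : nat) G
    of Group G & SmoothManifold R n G := {
  mulg_smooth : smooth_map2 (fun g h : G => (g * h)%g);
  invg_smooth : smooth_map (fun g : G => (g^-1)%g)
}.

#[short(type="lieGroupType")]
HB.structure Definition LieGroup (R : realType) (n : nat) :=
  {G of isLieGroup R n G & Group G & SmoothManifold R n G}.

Section VectorFields.
Context {R : realType} {n : nat} {M : smoothManifoldType R n}.

(* The tangent space at [p] is identified with 'rV[R]_n through [chart p];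
   a vector field assigns to [p] a vector of coordinates in [chart p]. *)
Definition vfield : Type := M -> 'rV[R]_n.

Definition tangent_map (f : M -> M) (p : M) : 'rV[R]_n -> 'rV[R]_n :=
  'd (chart (f p) \o f \o chartV p) (chart p p).

Definition vf_in_chart (p : M) (X : vfield) (x : 'rV[R]_n) : 'rV[R]_n :=
  let q := chartV p x in 'd (chart p \o chartV q) (chart q q) (X q).

Definition smooth_vfield (X : vfield) : Prop :=
  forall p, smooth_on (chart p @` chart_dom p) (vf_in_chart p X).

(* The bracket whose action on functions is f |-> X (Y f) - Y (X f). *)
Definition lie_bracket (X Y : vfield) : vfield := fun p =>
  'd (vf_in_chart p Y) (chart p p) (X p)
  - 'd (vf_in_chart p X) (chart p p) (Y p).

Definition has_velocity (c : R -> M) (t : R) (v : 'rV[R]_n) : Prop :=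
  {for t, continuous c} /\
  is_derive t (1 : R) (fun s => chart (c t) (c s)) v.

Definition integral_curve (X : vfield) (c : R -> M) : Prop :=
  forall t, has_velocity c t (X (c t)).

Definition is_flow (X : vfield) (phi : R -> M -> M) : Prop :=
  forall p, phi 0 p = p /\ integral_curve X (phi^~ p).

End VectorFields.
Arguments vfield {R n} M.

Section LieGroups.
Context {R : realType} {n : nat} {G : lieGroupType R n}.

Definition right_invariant (X : vfield G) : Prop :=
  smooth_vfield X /\
  forall a g : G, X (g * a)%g = tangent_map (fun h : G => (h * a)%g) g (X g).

Definition lie_automorphism (f : G -> G) : Prop :=
  [/\ {morph f : g h / (g * h)%g}, smooth_map f
    & exists2 f' : G -> G, cancel f f' /\ cancel f' f & smooth_map f'].

Definition linear_vfield (X : vfield G) : Prop :=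
  smooth_vfield X /\
  exists phi : R -> G -> G,
    [/\ is_flow X phi,
        forall s t g, phi (s + t) g = phi s (phi t g)
      & forall t, lie_automorphism (phi t)].

Definition associated_derivation (X Z : vfield G) : vfield G :=
  fun g => - lie_bracket X Z g.

Definition inner_derivation (D : vfield G -> vfield G) : Prop :=
  exists2 W : vfield G, right_invariant W &
    forall Z, right_invariant Z -> forall g, D Z g = lie_bracket W Z g.

(* The push-forward I_* X, for I the inversion of [G]. *)
Definition dI (X : vfield G) : vfield G := fun g =>
  tangent_map (fun h : G => (h^-1)%g) (g^-1)%g (X (g^-1)%g).

(* For a right invariant [X], the point c 1 on the (unique, complete) integral
   curve [c] of [X] with c 0 = e. *)
Definition lie_exp (X : vfield G) : G :=
  xget (1%g : G)
    [set h | exists c : R -> G, [/\ integral_curve X c, c 0 = 1%g & c 1 = h]].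

End LieGroups.

Section ControlSystems.
Context {R : realType} {n m : nat} {M : smoothManifoldType R n}.

Definition affine_comb (X : 'I_m.+1 -> vfield M) (u : 'rV[R]_m) : vfield M :=
  fun p => X ord0 p + \sum_(j < m) u 0 j *: X (lift ord0 j) p.

Definition piecewise_constant (T : R) (u : R -> 'rV[R]_m) : Prop :=
  exists2 s : seq R, path <%R 0 s && (last 0 s == T) &
    forall i, (i < size s)%N -> exists v : 'rV[R]_m,
      forall t, nth 0 (0 :: s) i < t < nth 0 s i -> u t = v.

Definition admissible_control (U : set 'rV[R]_m) (T : R)
    (u : R -> 'rV[R]_m) : Prop :=
  piecewise_constant T u /\ forall t, 0 <= t <= T -> U (u t).

(* Continuous curves satisfying the equation except at finitely many times:
   the Caratheodory solutions for a piecewise constant control. *)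
Definition solution (F : 'rV[R]_m -> vfield M) (T : R) (u : R -> 'rV[R]_m)
    (c : R -> M) : Prop :=
  {within `[0, T], continuous c} /\
  exists s : seq R, forall t, 0 < t < T -> t \notin s ->
    has_velocity c t (F (u t) (c t)).

Definition reachable_at (F : 'rV[R]_m -> vfield M) (U : set 'rV[R]_m)
    (T : R) (p : M) : set M :=
  [set q | exists (u : R -> 'rV[R]_m) (c : R -> M),
    [/\ admissible_control U T u, solution F T u c, c 0 = p & c T = q]].

Definition reachable (F : 'rV[R]_m -> vfield M) (U : set 'rV[R]_m)
    (p : M) : set M :=
  \bigcup_(T in [set T : R | 0 < T]) reachable_at F U T p.

Definition controllable (F : 'rV[R]_m -> vfield M) (U : set 'rV[R]_m) : Prop :=
  forall p : M, reachable F U p = [set: M].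

End ControlSystems.

(* Main.v *)
Require Import Defs.
From HB Require Import structures.
From mathcomp Require Import all_boot all_order all_algebra.
From mathcomp Require Import all_classical all_reals all_analysis.
From mathcomp Require Import ring lra.

(** Write [X_u] for the affine combination of the [X_i] with coefficients
    [(1, u)], and [Z_u] for that of the [X_i + Y_i].  Since the flow of a right
    invariant field is a left translation by its exponential, and that of
    [dI X_u] is the right translation by [exp (- t X_u)], the affine system with
    constant control [u] has the flow
      [g |-> exp (t Z_u) g exp (- t X_u)].
    Hence a trajectory [c] of the invariant system from [1], with a given
    control, yields the trajectories [c(t) p k(t)^-1] of the affine system with
    the same control, where [k] is the integral of the fields [X_u] along that
    control ([has_velocity_sandwich], [steering_curve], [reachable_transfer]).
    So, if [h] is reachable from [1] in the invariant system, then there is a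
    product [e] of exponentials [exp (t X_u)], the same for all [p], such that
    [h p e^-1] is reachable from [p] in the affine system.

    If the affine system is controllable, the exponentials [exp (t X_u)] are
    trivially reachable from [1].  Conversely, suppose that they are.  The
    exponentials [exp (t X_u)] commute, and right translation by an element that
    commutes with them maps trajectories of the affine system to trajectories
    ([reachable_mulr]); so every product of exponentials is reachable from [1],
    and [1] is reachable from the inverse of every such product.
    Given [p] and [q], the choice [h = p^-1] leads from [p] to some [e1^-1],
    then from there to [1]; from [1] the element [e2] attached to [h = q] is
    reached, and [h = q] leads from [e2] to [q e2 e2^-1 = q]
    ([controllable_of_exp]).

    The analytic work is to have the exponentials at all, and to make them
    commute.  The velocity of a product of curves is the sum of the velocities
    obtained by freezing either factor ([has_velocity_mul]); this makes integral
    curves of right invariant fields unique, because the quotient of two of them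
    has zero velocity ([integral_curve_unique]).  For existence
    ([one_parameter_exists]), a curve [step v h] with velocity [v] at [1] gives
    the Euler polygons [(step v (1/N)) ^ floor (t N)], which for small [t] remain
    in a compact ball of the chart, hence converge along an ultrafilter.  The
    limit is a homomorphism because the floors are additive up to 1, and an
    estimate of the polygons gives its derivative at 0.
    For commutation ([exp_curve_commute]), the bracket at the identity is the
    antisymmetrization of the mixed second derivative of the multiplication
    ([lie_bracket1]); by the symmetry of second derivatives ([second_diff_sym])
    it is also, up to sign, the derivative at 0 of [s |-> Ad (exp (s X)) Y]
    ([Ad_velocity0]).  If it vanishes, this map is constant, so conjugation by
    [exp (s X)] fixes the initial velocity of [exp (t Y)], hence the whole
    curve. *)

Set Implicit Arguments.
Unset Strict Implicit.
Unset Printing Implicit Defensive.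

Import Order.TTheory GRing.Theory Num.Theory.
Import numFieldNormedType.Exports.
Local Open Scope classical_set_scope.
Local Open Scope ring_scope.

(** * Calculus of maps between spaces of row vectors *)

Lemma ler_coord_norm (R : realType) (n : nat) (w : 'rV[R]_n) j : `|w 0 j| <= `|w|.
Proof.
rewrite {2}/Num.norm /= mx_normrE.
by apply: (@le_bigmax_cond _ _ _ _ (0, j) predT (fun ij => `|w ij.1 ij.2|)).
Qed.

Section MeanValue.
Context {R : realType}.

(** A linear map is a finite combination of the coordinate functions. *)
Lemma rV_linear_continuous (a : nat) (W : normedModType R)
  (f : {linear 'rV[R]_a -> W}) : continuous f.
Proof.
have -> : (f : _ -> _) =
    \sum_(j < a) (fun x : 'rV[R]_a => x 0 j *: f (delta_mx 0 j)).
  apply/funext => x; rewrite fct_sumE {1}(row_sum_delta x) linear_sum.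
  by apply: eq_bigr => j _; rewrite linearZ.
suff H (x : 'rV[R]_a) : {for x, continuous (\sum_(j < a)
    (fun x : 'rV[R]_a => x 0 j *: f (delta_mx 0 j)))} by move=> x; exact: H.
elim/big_ind : _ => [|g h gc hc|j _].
- exact: (@cst_continuous _ _ (0 : W)).
- exact: continuousD.
- by apply: continuousZr_tmp; exact: (@coord_continuous R 1 a 0 j x).
Qed.

(** Explicit bounds replace the little-o in the estimates below, where several
    differentiability statements are added up. *)
Lemma diff_eps (V W : normedModType R) (f : V -> W) (x : V) : differentiable f x ->
  forall e : R, 0 < e -> exists2 d : R, 0 < d &
    forall k, `|k| < d -> `|f (x + k) - f x - 'd f x k| <= e * `|k|.
Proof.
move=> /diff_locallyP[_ /eqaddoP fE] e e0.
have /nbhs_normP[d /= d0 H] := fE _ e0; exists d => // k kd.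
have /= := H k; rewrite sub0r normrN => /(_ kd).
by rewrite !fctE /= opprD addrA (addrC k).
Qed.

(** The converse of [diff_eps] for curves. *)
Lemma eps_is_derive (W : normedModType R) (f : R -> W) (t : R) (v : W) :
  (forall e : R, 0 < e -> exists2 d : R, 0 < d &
    forall h, `|h| < d -> `|f (t + h) - f t - h *: v| <= e * `|h|) ->
  is_derive t (1 : R) f v.
Proof.
move=> H.
have cv : h^-1 *: ((f \o shift t) (h *: (1:R)) - f t) @[h --> 0^'] --> v.
  apply/cvgrPdist_le => e e0; have [d d0 Hd] := H e e0.
  near=> h.
  have h0 : h != 0 by near: h; exact: nbhs_dnbhs_neq.
  have hd : `|h| < d by near: h; apply: dnbhs0_lt.
  rewrite distrC /= -[X in `|_ - X|](scalerK h0) -scalerBr normrZ [h *: 1]mulr1.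
  by rewrite normfV mulrC ler_pdivrMr ?normr_gt0// (addrC h); exact: Hd.
apply: DeriveDef; last exact/cvg_lim.
by apply/cvg_ex; exists v.
Unshelve. all: by end_near. Qed.

(** Applied to a single coordinate, the mean value theorem gives an intermediate
    point; the points differ from one coordinate to another, but each satisfies the
    bound, and the norm of a row vector is the maximum of its coordinates. *)
Lemma mean_value_le (b : nat) (f df : R -> 'rV[R]_b) (x y : R) (v : 'rV[R]_b) (e : R) :
  x <= y -> 0 <= e ->
  (forall s, x <= s <= y -> is_derive s (1 : R) f (df s)) ->
  (forall s, x <= s <= y -> `|df s - v| <= e) ->
  `|f y - f x - (y - x) *: v| <= e * (y - x).
Proof.
move=> xy e0 fd dfe.
rewrite {1}/Num.norm /= mx_normrE; apply/bigmax_leP; split => [|[i j] _].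
  by rewrite mulr_ge0// subr_ge0.
rewrite /= ord1 !mxE.
have fjd s : x <= s <= y -> is_derive s (1 : R) (fun r => f r 0 j) (df s 0 j).
  move=> sxy; have D := fd s sxy; have fs := @ex_derive _ _ _ _ _ _ _ D.
  apply: DeriveDef; first exact: (derivable_mxP _ _ _).1.
  by rewrite -(@derive_val _ _ _ _ _ _ _ D) derive_mx // mxE.
have [||c] := @MVT_segment R (fun s => f s 0 j) (fun s => df s 0 j) x y xy.
- by move=> s; rewrite in_itv/= => /andP[xs sy]; apply: fjd; rewrite !ltW.
- apply: derivable_within_continuous => s; rewrite in_itv/= => sxy.
  by have := fjd s sxy => ?; exact: ex_derive.
rewrite in_itv/= => cxy /= ->.
have := dfe c cxy; rewrite {1}/Num.norm /= mx_normrE => /bigmax_leP[_ /(_ (0, j))].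
rewrite /= !mxE => /(_ isT) H.
rewrite [df c 0 j * _]mulrC -mulrBr normrM ger0_norm ?subr_ge0// [e * _]mulrC.
by rewrite ler_wpM2l ?subr_ge0.
Qed.
End MeanValue.

Section Calculus.
Context {R : realType}.

Lemma is_derive_comp (V W : normedModType R) (F : V -> W) (g : R -> V) (t : R) (v : V) :
  is_derive t (1 : R) g v -> differentiable F (g t) ->
  is_derive t (1 : R) (F \o g) ('d F (g t) v).
Proof.
move=> gv dF.
have dg : differentiable g t by apply/derivable1_diffP; exact: ex_derive.
have dFg : differentiable (F \o g) t by exact: differentiable_comp.
apply: DeriveDef; first exact/derivable1_diffP.
rewrite deriveE// diff_comp//=; congr ('d F (g t) _).
by rewrite -deriveE// (@derive_val _ _ _ _ _ _ _ gv).
Qed.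

Lemma is_derive_line (V : normedModType R) (z u : V) (s : R) :
  is_derive s (1 : R) (fun r : R => z + r *: u) u.
Proof.
apply: eps_is_derive => e e0; exists 1 => // h _.
rewrite scalerDl addrA [_ + h *: u]addrC addrK subrr normr0.
by rewrite mulr_ge0// ltW.
Qed.

Lemma is_derive_translate (W : normedModType R) (f : R -> W) t v :
  is_derive (0 : R) (1 : R) (fun r => f (r + t)) v -> is_derive t (1 : R) f v.
Proof.
have E : (fun h => h^-1 *: (((fun r => f (r + t)) \o shift 0) (h *: (1 : R)) - f (0 + t)))
       = (fun h => h^-1 *: ((f \o shift t) (h *: (1 : R)) - f t)).
  by apply/funext => h; rewrite /= add0r addr0.
by move=> [H1 H2]; apply: DeriveDef; rewrite /derivable /derive -E.
Qed.

Lemma diff_linear_comb (a b : nat) (k : R) (f g : 'rV[R]_a -> 'rV[R]_b) x t :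
  differentiable f x -> differentiable g x ->
  'd (k \*: f + g) x t = k *: 'd f x t + 'd g x t.
Proof.
move=> fx gx; have kfx := differentiableZ k fx.
have D := congr1 (@^~ t) (diffD kfx gx).
have DZ := congr1 (@^~ t) (diffZ k fx).
by apply: (etrans D); congr (_ + _); exact: DZ.
Qed.

(** The second difference of [f] along [u] and [v] is the increment, between 0
    and [t], of [s |-> f (z + t v + s u) - f (z + s u)].  The derivative of this
    function is an increment of ['d f _ u], which is close to [t A v] by the
    differentiability of ['d f _ u] at [z]; the mean value inequality concludes. *)
Lemma second_difference (a b : nat) (f : 'rV[R]_a -> 'rV[R]_b) (z u v : 'rV[R]_a)
  (A : {linear 'rV[R]_a -> 'rV[R]_b}) :
  (\forall y \near z, differentiable f y) ->
  (forall e : R, 0 < e -> exists2 d : R, 0 < d &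
    forall k, `|k| < d -> `|'d f (z + k) u - 'd f z u - A k| <= e * `|k|) ->
  forall e : R, 0 < e -> exists2 d : R, 0 < d & forall t : R, 0 < t < d ->
    `|f (z + t *: u + t *: v) - f (z + t *: u) - f (z + t *: v) + f z
      - (t * t) *: A v|
    <= e * (t * t) * (`|u| + `|u| + `|v|).
Proof.
move=> /nbhs_normP[d1 /= d10 fd] gdif e e0.
have [d2 d20 gE] := gdif _ e0.
(* The summand 1 only serves to make the denominator positive. *)
pose N : R := `|u| + `|v| + 1.
have N0 : 0 < N by rewrite ltr_wpDl// addr_ge0.
pose d := Num.min (d1 / N) (d2 / N).
have d0 : 0 < d by rewrite lt_min !divr_gt0.
exists d => // t /andP[t0 td].
have small (s r : R) : 0 <= s <= t -> 0 <= r <= t ->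
    `|s *: u + r *: v| < Num.min d1 d2.
  move=> /andP[s0 st] /andP[r0 rt].
  have : `|s *: u + r *: v| <= t * (`|u| + `|v|).
    apply: (le_trans (ler_normD _ _)); rewrite !normrZ mulrDr lerD//.
      by rewrite ger0_norm// ler_wpM2r.
    by rewrite ger0_norm// ler_wpM2r.
  move=> /le_lt_trans; apply.
  have : t * N < Num.min d1 d2.
    by move: td; rewrite /d !lt_min !ltr_pdivlMr.
  apply: le_lt_trans; rewrite ler_wpM2l ?(ltW t0)// /N; lra.
have fdiff (s r : R) : 0 <= s <= t -> 0 <= r <= t ->
    differentiable f (z + (s *: u + r *: v)).
  move=> s0 r0; apply: fd; rewrite /= opprD addrA subrr add0r normrN.
  by have := small s r s0 r0; rewrite lt_min => /andP[].
have gdiff (s r : R) : 0 <= s <= t -> 0 <= r <= t ->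
   `|'d f (z + (s *: u + r *: v)) u - 'd f z u - A (s *: u + r *: v)| <= e * `|s *: u + r *: v|.
  move=> s0 r0; apply: gE.
  by have := small s r s0 r0; rewrite lt_min => /andP[].
have t0t : 0 <= t <= t by rewrite lexx ltW.
have o0t : 0 <= (0 : R) <= t by rewrite lexx ltW.
pose phi (s : R) := f (z + t *: v + s *: u) - f (z + s *: u).
pose dphi (s : R) := 'd f (z + t *: v + s *: u) u - 'd f (z + s *: u) u.
have := @mean_value_le R b phi dphi 0 t (t *: A v) (e * t * (`|u| + `|u| + `|v|)) (ltW t0).
rewrite /phi !scale0r !addr0 subr0 scalerA opprB.
have -> : e * t * (`|u| + `|u| + `|v|) * t = e * (t * t) * (`|u| + `|u| + `|v|) by ring.
rewrite addrA (addrAC z (t *: v) (t *: u)) (addrAC _ (f z)).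
apply.
- by rewrite !mulr_ge0// ?addr_ge0 ?(ltW e0) ?(ltW t0).
- move=> s st; apply: is_deriveB; apply: (is_derive_comp (is_derive_line _ _ _)).
    by have := fdiff s t st t0t; rewrite addrA addrAC.
  by have := fdiff s 0 st o0t; rewrite scale0r addr0.
move=> s st; rewrite /dphi (addrAC z) -(addrA z).
have := gdiff s t st t0t; have := gdiff s 0 st o0t.
rewrite scale0r addr0.
have -> : A (s *: u + t *: v) = A (s *: u) + t *: A v by rewrite linearD [A (t *: v)]linearZ.
move=> H1 H2.
(* The increment of ['d f _ u] is taken between [z + s u] and
   [z + s u + t v], while its differentiability compares both with [z]. *)
have split_diff (q p w x y : 'rV[R]_b) : q - p - y = (q - w - (x + y)) - (p - w - x).
  by apply/rowP => i; rewrite !mxE; ring.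
rewrite (split_diff _ _ ('d f z u) (A (s *: u))).
apply: le_trans (ler_normB _ _) _; apply: le_trans (lerD H2 H1) _.
have su : `|s *: u| <= t * `|u|.
  by move/andP: st => [s0 st]; rewrite normrZ ger0_norm// ler_wpM2r.
have tv : `|t *: v| = t * `|v| by rewrite normrZ gtr0_norm.
rewrite -mulrDr -mulrA ler_wpM2l ?(ltW e0)//.
have := ler_normD (s *: u) (t *: v); lra.
Qed.

(** The second difference is symmetric in [u] and [v], so that its two limits,
    after division by [t^2], agree. *)
Lemma second_diff_sym_estimate (a b : nat) (f : 'rV[R]_a -> 'rV[R]_b) (z u v : 'rV[R]_a)
  (A B : {linear 'rV[R]_a -> 'rV[R]_b}) :
  (\forall y \near z, differentiable f y) ->
  (forall e : R, 0 < e -> exists2 d : R, 0 < d &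
    forall k, `|k| < d -> `|'d f (z + k) u - 'd f z u - A k| <= e * `|k|) ->
  (forall e : R, 0 < e -> exists2 d : R, 0 < d &
    forall k, `|k| < d -> `|'d f (z + k) v - 'd f z v - B k| <= e * `|k|) ->
  A v = B u.
Proof.
move=> fd gu gv.
pose C : R := `|u| + `|u| + `|v| + (`|v| + `|v| + `|u|).
have C0 : 0 <= C by rewrite !addr_ge0.
apply/eqP; rewrite -subr_eq0 -normr_le0; apply/ler_addgt0Pl => e e0.
rewrite addr0.
have e'0 : 0 < e / (C + 1) by rewrite divr_gt0// ltr_wpDl.
have [d1 d10 H1] := second_difference v fd gu e'0.
have [d2 d20 H2] := second_difference u fd gv e'0.
pose t := Num.min d1 d2 / 2.
have t0 : 0 < t by rewrite divr_gt0// lt_min d10 d20.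
have /andP[t1 t2] : (t < d1) && (t < d2).
  have : Num.min d1 d2 <= d1 /\ Num.min d1 d2 <= d2 by rewrite !ge_min !lexx orbT.
  rewrite /t; lra.
have := H1 t; have := H2 t; rewrite t0 t1 t2 /= => /(_ isT) K2 /(_ isT) K1.
have : `|(t * t) *: (A v - B u)| <= e / (C + 1) * (t * t) * C.
  rewrite [X in _ <= _ * X](_ : C = (`|v| + `|v| + `|u|) + (`|u| + `|u| + `|v|)); last first.
    by rewrite /C; ring.
  rewrite mulrDr; apply: le_trans (lerD K2 K1).
  apply: le_trans (ler_normB _ _); rewrite le_eqVlt; apply/orP; left; apply/eqP.
  congr (`|_|); rewrite (addrAC z (t *: v)).
 by apply/rowP => i; rewrite !mxE; ring.
have tt0 : 0 < t * t by rewrite mulr_gt0 ?t0.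
rewrite normrZ gtr0_norm//.
have -> : e / (C + 1) * (t * t) * C = (t * t) * (e / (C + 1) * C) by ring.
rewrite ler_pM2l// => /le_trans; apply.
by rewrite -mulrA ger_pMr// mulrC ler_pdivrMr ?ltr_wpDl// mul1r lerDl.
Qed.

(** Young's theorem. *)
Lemma second_diff_sym (a b : nat) (f : 'rV[R]_a -> 'rV[R]_b) (z u v : 'rV[R]_a) :
  (\forall y \near z, differentiable f y) ->
  differentiable (fun y => 'd f y u) z ->
  differentiable (fun y => 'd f y v) z ->
  'd (fun y => 'd f y u) z v = 'd (fun y => 'd f y v) z u.
Proof.
by move=> fd /diff_eps gu /diff_eps gv; exact: second_diff_sym_estimate gu gv.
Qed.

End Calculus.

(** * Velocities of curves on a manifold *)

Section Velocities.
Context {R : realType} {n : nat} {M : smoothManifoldType R n}.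
Implicit Types (p q x : M) (c : R -> M) (t : R) (v w : 'rV[R]_n).

Lemma chart_dom_near (T : topologicalType) (c : T -> M) (t : T) p :
  {for t, continuous c} -> chart_dom p (c t) ->
  \forall s \near t, chart_dom p (c s).
Proof.
move=> cc pc; apply: (cc (chart_dom p)); apply: open_nbhs_nbhs; split => //.
exact: chart_dom_open.
Qed.

Lemma transition_differentiable p q x : chart_dom p x -> chart_dom q x ->
  differentiable (chart q \o chartV p) (chart p x).
Proof.
by move=> px qx; have [+ _] := chart_transition p q 1; apply; exists x.
Qed.

Lemma smooth_map_differentiable (f : M -> M) p q x : smooth_map f ->
  chart_dom p x -> chart_dom q (f x) ->
  differentiable (chart q \o f \o chartV p) (chart p x).
Proof.
by move=> [_ fs] px qfx; have [+ _] := fs p q 1; apply; exists x.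
Qed.

(** A velocity is expressed in the chart centred at the current point; this
    lemma changes the chart. *)
Lemma has_velocity_chart c t v p : has_velocity c t v -> chart_dom p (c t) ->
  is_derive t (1 : R) (fun s => chart p (c s))
    ('d (chart p \o chartV (c t)) (chart (c t) (c t)) v).
Proof.
move=> [cc cv] pc; set q := c t.
have qc : chart_dom q (c t) := chart_dom_center _.
have D := is_derive_comp cv (transition_differentiable qc pc).
apply: near_eq_is_derive D.
by apply: filterS (chart_dom_near cc qc) => s qs; rewrite /= chartK.
Qed.

Lemma has_velocity_near c d t v : (\forall s \near t, c s = d s) ->
  has_velocity c t v -> has_velocity d t v.
Proof.
move=> cd [cc cv]; have ct : c t = d t := nbhs_singleton cd; split.
  apply: cvg_trans; last by rewrite -ct; exact: cc.
  exact: near_eq_cvg.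
apply: near_eq_is_derive cv; rewrite -ct.
by apply: filterS cd => s ->.
Qed.

Lemma has_velocity_unique c t v w :
  has_velocity c t v -> has_velocity c t w -> v = w.
Proof. by move=> [_ [_ <-]] [_ [_ <-]]. Qed.

Lemma has_velocity_cst p t : has_velocity (fun=> p) t 0.
Proof. by split; [exact: cst_continuous|exact: is_derive_cst]. Qed.

Lemma has_velocity_map (f : M -> M) c t v : smooth_map f ->
  has_velocity c t v -> has_velocity (f \o c) t (tangent_map f (c t) v).
Proof.
move=> fs [cc cv]; split.
  by apply: continuous_comp => //; apply: fs.1.
have D := is_derive_comp cv (smooth_map_differentiable fs (chart_dom_center (c t))
  (chart_dom_center (f (c t)))).
apply: near_eq_is_derive D.
apply: filterS (chart_dom_near cc (chart_dom_center _)) => s qs.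
by rewrite /= chartK.
Qed.

Lemma has_velocity_reparam c (k b t : R) v :
  has_velocity c (k * t + b) v -> has_velocity (fun s => c (k * s + b)) t (k *: v).
Proof.
move=> [cc cv].
have D : is_derive t (1 : R) (fun s : R => k * s + b : R) k.
  apply: eps_is_derive => e e0; exists 1 => // h _.
  have -> : k * (t + h) + b - (k * t + b) - h *: k = 0 by rewrite /GRing.scale/=; ring.
  by rewrite normr0 mulr_ge0// ltW.
have Dd : differentiable (fun s : R => k * s + b : R) t.
  by apply/derivable1_diffP; exact: ex_derive.
split.
  apply: (@continuous_comp _ _ _ (fun s => k * s + b) c) => //.
  exact: differentiable_continuous.
have cd : differentiable (fun s => chart (c (k * t + b)) (c s)) (k * t + b).
  by apply/derivable1_diffP; exact: ex_derive.
have := is_derive_comp D cd; congr is_derive.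
rewrite -[X in 'd _ _ X]mulr1 linearZ/=; congr (_ *: _).
by rewrite -deriveE// (@derive_val _ _ _ _ _ _ _ cv).
Qed.

(** Every tangent vector is a velocity.  Identities between tangent maps are
    proved below by applying both sides to such curves and by the uniqueness of
    velocities, which avoids chain rules between charts. *)
Lemma velocity_curve p v : exists2 c, c 0 = p & has_velocity c 0 v.
Proof.
pose l s := chart p p + s *: v.
have l0 : l 0 = chart p p by rewrite /l scale0r addr0.
have c0 : chartV p (l 0) = p by rewrite l0 chartK//; exact: chart_dom_center.
exists (chartV p \o l) => //=.
have lc : {for 0, continuous l}.
  apply: differentiable_continuous; apply/derivable1_diffP.
  by have := is_derive_line (chart p p) v 0 => ?; exact: ex_derive.
have im : (chart p @` chart_dom p) (l 0).
  by rewrite l0; exists p => //; exact: chart_dom_center.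
split.
  by apply: continuous_comp => //; exact: chartV_continuous im.
rewrite /= c0; apply: near_eq_is_derive (is_derive_line (chart p p) v 0).
have : \forall s \near (0:R), (chart p @` chart_dom p) (l s).
  apply: lc; apply: open_nbhs_nbhs; split => //; exact: chart_image_open.
by apply: filterS => s; rewrite -/(l s) => -[x px <-]; rewrite chartK.
Qed.

(** In a chart around [c t], the curve has zero derivative near [t], so that it
    is locally constant; the line is connected. *)
Lemma velocity0_cst c : (forall t, has_velocity c t 0) -> forall t, c t = c 0.
Proof.
move=> c0.
have loc t : \forall s \near t, c s = c t.
  pose p := c t.
  have := chart_dom_near (c0 t).1 (chart_dom_center p).
  move=> /nbhs_normP[d /= d0 cp].
  apply/nbhs_normP; exists d => //= s /= st.
  have cst (a b : R) : a <= b -> `|t - a| < d -> `|t - b| < d -> c a = c b.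
    move=> ab ta tb.
    have bet r : a <= r <= b -> chart_dom p (c r).
      move=> /andP[ar rb]; apply: cp => /=; move: ta tb; rewrite !ltr_norml.
      by move=> /andP[? ?] /andP[? ?]; apply/andP; split; lra.
    rewrite -(chartK p (c a)); last by apply: bet; rewrite lexx.
    rewrite -(chartK p (c b)); last by apply: bet; rewrite lexx ab.
    have : `|chart p (c b) - chart p (c a) - (b - a) *: 0| <= 0 * (b - a).
      apply: (@mean_value_le R n (fun s => chart p (c s)) (fun=> 0)) => // [r rab|r _].
        by have := has_velocity_chart (c0 r) (bet r rab); rewrite linear0.
      by rewrite subrr normr0.
    rewrite mul0r scaler0 subr0 normr_le0 subr_eq0 => /eqP E.
    by congr (chartV p _).
  have tt : `|t - t| < d by rewrite subrr normr0.
  case: (leP s t) => [le_st|/ltW le_ts]; first exact: cst.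
  by apply/esym; exact: cst.
have conn : connected [set: R] by apply/connected_intervalP => x y _ _ z _.
have E : [set t | c t = c 0] = setT.
  apply: conn; first by exists 0.
    exists [set t | c t = c 0]; last by rewrite setTI.
    by rewrite openE => t /= <-; exact: loc.
  exists [set t | c t = c 0]; last by rewrite setTI.
  rewrite -[X in closed X]setCK; apply: open_closedC.
  rewrite openE => t /= ct; near=> s; rewrite /= => cs; apply: ct.
  by rewrite -cs; apply/esym; near: s; exact: loc.
by move=> t; have : [set t | c t = c 0] t by rewrite E.
Unshelve. all: by end_near. Qed.

End Velocities.

(** * Velocities of products and inverses in a Lie group *)

Section RowMx.
Context {R : realType} {n : nat}.

(** The two injections are written as matrix products because these carry the
    structure of linear maps. *)
Definition inl_mx : 'rV[R]_n -> 'rV[R]_(n + n) := mulmxr (row_mx 1%:M 0).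
Definition inr_mx : 'rV[R]_n -> 'rV[R]_(n + n) := mulmxr (row_mx 0 1%:M).
HB.instance Definition _ := GRing.Linear.on inl_mx.
HB.instance Definition _ := GRing.Linear.on inr_mx.

Lemma inl_mxE u : inl_mx u = row_mx u 0.
Proof. by rewrite /inl_mx /= mul_mx_row mulmx1 mulmx0. Qed.

Lemma inr_mxE u : inr_mx u = row_mx 0 u.
Proof. by rewrite /inr_mx /= mul_mx_row mulmx1 mulmx0. Qed.

Lemma row_mx_split u v : row_mx u v = inl_mx u + inr_mx v.
Proof. by rewrite inl_mxE inr_mxE add_row_mx addr0 add0r. Qed.

Lemma is_derive_linear (a b : nat) (L : {linear 'rV[R]_a -> 'rV[R]_b})
    (g : R -> 'rV[R]_a) (t : R) v :
  is_derive t (1 : R) g v -> is_derive t (1 : R) (fun s => L (g s)) (L v).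
Proof.
move=> gv; have Lc := @rV_linear_continuous R a _ L.
have := is_derive_comp gv (linear_differentiable (g t) Lc).
by rewrite (diff_lin (g t) Lc).
Qed.

Lemma is_derive_row_mx (f g : R -> 'rV[R]_n) (t : R) u v :
  is_derive t (1 : R) f u -> is_derive t (1 : R) g v ->
  is_derive t (1 : R) (fun s => row_mx (f s) (g s)) (row_mx u v).
Proof.
move=> fu gv; rewrite row_mx_split.
have -> : (fun s => row_mx (f s) (g s)) =
  (fun s => inl_mx (f s)) + (fun s => inr_mx (g s)).
  by apply/funext => s; rewrite row_mx_split.
by apply: is_deriveD; exact: is_derive_linear.
Qed.

Lemma is_diff_linear (a b : nat) (L : {linear 'rV[R]_a -> 'rV[R]_b}) x : is_diff x L L.
Proof.
have Lc := @rV_linear_continuous R a _ L.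
by apply: DiffDef; [exact: linear_differentiable|exact: diff_lin].
Qed.

Lemma is_diff_row_mxl (b x : 'rV[R]_n) : is_diff x (fun a => row_mx a b) inl_mx.
Proof.
have -> : (fun a => row_mx a b) = (inl_mx : _ -> _) + cst (inr_mx b).
  by apply/funext => a; rewrite row_mx_split.
have D := @is_diff_linear _ _ inl_mx x.
by apply: is_diff_eq; rewrite addr0.
Qed.

Lemma is_diff_row_mxr (b x : 'rV[R]_n) : is_diff x (fun a => row_mx b a) inr_mx.
Proof.
have -> : (fun a => row_mx b a) = cst (inl_mx b) + (inr_mx : _ -> _).
  by apply/funext => a; rewrite row_mx_split.
have D := @is_diff_linear _ _ inr_mx x.
by apply: is_diff_eq; rewrite add0r.
Qed.

End RowMx.

Section LieGroupVelocities.
Context {R : realType} {n : nat} {G : lieGroupType R n}.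
Implicit Types (p q r x y g h : G) (c d : R -> G) (t : R) (v w : 'rV[R]_n).

Definition mul_in_charts p q r (z : 'rV[R]_(n + n)) : 'rV[R]_n :=
  chart r (chartV p (lsubmx z) * chartV q (rsubmx z))%g.

Lemma mul_in_charts_diff p q r x y :
  chart_dom p x -> chart_dom q y -> chart_dom r (x * y)%g ->
  differentiable (mul_in_charts p q r) (row_mx (chart p x) (chart q y)).
Proof.
move=> px qy rxy.
have [+ _] := (@mulg_smooth R n G).2 p q r 1; apply.
by exists (x, y).
Qed.

Lemma mulg_continuous (T : topologicalType) (c d : T -> G) (t : T) :
  {for t, continuous c} -> {for t, continuous d} ->
  {for t, continuous (fun s => (c s * d s)%g)}.
Proof.
move=> cc dc.
apply: (@continuous2_cvg _ _ _ _ _ _ c d (fun x y => (x * y)%g)) => //.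
by have H := (@mulg_smooth R n G).1 (c t, d t); exact: H.
Qed.

Lemma diff_mulgr p q r x y :
  chart_dom p x -> chart_dom q y -> chart_dom r (x * y)%g -> forall v,
  'd (chart r \o (fun h => (h * y)%g) \o chartV p) (chart p x) v =
    'd (mul_in_charts p q r) (row_mx (chart p x) (chart q y)) (inl_mx v).
Proof.
move=> px qy rxy v; have D := mul_in_charts_diff px qy rxy.
have -> : chart r \o (fun h => (h * y)%g) \o chartV p =
    mul_in_charts p q r \o (fun a => row_mx a (chart q y)).
  by apply/funext => a; rewrite /= /mul_in_charts row_mxKl row_mxKr (chartK q y).
have il := is_diff_row_mxl (chart q y) (chart p x).
by rewrite diff_comp//= diff_val.
Qed.

Lemma diff_mulgl p q r x y :
  chart_dom p x -> chart_dom q y -> chart_dom r (x * y)%g -> forall v,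
  'd (chart r \o (fun h => (x * h)%g) \o chartV q) (chart q y) v =
    'd (mul_in_charts p q r) (row_mx (chart p x) (chart q y)) (inr_mx v).
Proof.
move=> px qy rxy v; have D := mul_in_charts_diff px qy rxy.
have -> : chart r \o (fun h => (x * h)%g) \o chartV q =
    mul_in_charts p q r \o (fun a => row_mx (chart p x) a).
  by apply/funext => a; rewrite /= /mul_in_charts row_mxKl row_mxKr (chartK p x).
have il := is_diff_row_mxr (chart p x) (chart q y).
by rewrite diff_comp//= diff_val.
Qed.

Lemma tangent_map0 (f : G -> G) x : tangent_map f x 0 = 0.
Proof. exact: linear0. Qed.

Lemma tangent_mulgr x y v : tangent_map (fun h => (h * y)%g) x v =
  'd (mul_in_charts x y (x * y)%g) (row_mx (chart x x) (chart y y)) (inl_mx v).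
Proof. by apply: diff_mulgr; exact: chart_dom_center. Qed.

Lemma tangent_mulgl x y v : tangent_map (fun h => (x * h)%g) y v =
  'd (mul_in_charts x y (x * y)%g) (row_mx (chart x x) (chart y y)) (inr_mx v).
Proof. by apply: diff_mulgl; exact: chart_dom_center. Qed.

(** The differential of the multiplication at a pair is the sum of its
    partial differentials. *)
Lemma has_velocity_mul c d t v w : has_velocity c t v -> has_velocity d t w ->
  has_velocity (fun s => (c s * d s)%g) t
   (tangent_map (fun h => (h * d t)%g) (c t) v +
    tangent_map (fun h => (c t * h)%g) (d t) w).
Proof.
move=> [cc cv] [dc dw]; split; first exact: mulg_continuous.
have cD := chart_dom_center (c t); have dD := chart_dom_center (d t).
have eD := chart_dom_center (c t * d t)%g.
rewrite tangent_mulgr tangent_mulgl.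
rewrite -linearD -row_mx_split.
have := is_derive_comp (is_derive_row_mx cv dw) (mul_in_charts_diff cD dD eD).
apply: near_eq_is_derive.
near=> s; rewrite /= /mul_in_charts row_mxKl row_mxKr !chartK//.
- by near: s; exact: (chart_dom_near dc).
- by near: s; exact: (chart_dom_near cc).
Unshelve. all: by end_near. Qed.

Lemma has_velocity_mulr c t v g : has_velocity c t v ->
  has_velocity (fun s => (c s * g)%g) t (tangent_map (fun h => (h * g)%g) (c t) v).
Proof.
by move=> cv; have := has_velocity_mul cv (has_velocity_cst g t); rewrite tangent_map0 addr0.
Qed.

Lemma has_velocity_mull c t v g : has_velocity c t v ->
  has_velocity (fun s => (g * c s)%g) t (tangent_map (fun h => (g * h)%g) (c t) v).
Proof.
by move=> cv; have := has_velocity_mul (has_velocity_cst g t) cv; rewrite tangent_map0 add0r.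
Qed.

Lemma has_velocity_inv c t v : has_velocity c t v ->
  has_velocity (fun s => (c s)^-1%g) t (tangent_map (fun h : G => h^-1%g) (c t) v).
Proof. by apply: has_velocity_map; exact: invg_smooth. Qed.

(** The half of right invariance that concerns translations; it passes to linear
    combinations by mere linearity of the tangent maps. *)
Definition translation_invariant (X : vfield G) : Prop :=
  forall a g, X (g * a)%g = tangent_map (fun h => (h * a)%g) g (X g).

Lemma translate_curve (X : vfield G) c t g : translation_invariant X ->
  has_velocity c t (X (c t)) -> has_velocity (fun s => (c s * g)%g) t (X (c t * g)%g).
Proof. by move=> Xi cv; rewrite Xi; exact: has_velocity_mulr. Qed.

(** The velocity of [c^-1 d] at [t] depends only on the points and velocities of
    [c] and [d] at [t].  By invariance, [s |-> c s * k] with [k = (c t)^-1 d t] has the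
    same point and velocity at [t] as [d], and for this curve [c^-1 (c k)] is constant. *)
Lemma integral_curve_unique (X : vfield G) c d : translation_invariant X ->
  integral_curve X c -> integral_curve X d -> c 0 = d 0 -> c = d.
Proof.
move=> Xi cX dX cd0.
have e0 t : has_velocity (fun s => ((c s)^-1 * d s)%g) t 0.
  pose k := ((c t)^-1 * d t)%g.
  have ckt : (c t * k = d t)%g by rewrite mulgA mulgV mul1g.
  have ck : has_velocity (fun s => (c s * k)%g) t (X (d t)).
    by rewrite -ckt; exact: translate_curve.
  have ci := has_velocity_inv (cX t).
  have V1 := has_velocity_mul ci ck; have V2 := has_velocity_mul ci (dX t).
  rewrite ckt in V1.
  have V0 : has_velocity (fun s => ((c s)^-1 * (c s * k))%g) t 0.
    have -> : (fun s => ((c s)^-1 * (c s * k))%g) = fun=> k.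
      by apply/funext => s; rewrite mulgA mulVg mul1g.
    exact: has_velocity_cst.
  by rewrite -(has_velocity_unique V1 V0).
apply/funext => t; have := velocity0_cst e0 t; rewrite cd0 mulVg => E.
by rewrite -(mulg1 (c t)) -E mulgA mulgV mul1g.
Qed.

End LieGroupVelocities.

(** * The multiplication in the chart at the identity *)

Lemma ler_norm_row_mx (R : realType) (n : nat) (u v : 'rV[R]_n) :
  `|row_mx u v| <= `|u| + `|v|.
Proof.
rewrite {1}/Num.norm /= mx_normrE; apply/bigmax_leP; split => [|[i j] _].
  by rewrite addr_ge0.
rewrite /= ord1; case: (split_ordP j) => k ->.
  by rewrite row_mxEl; apply: le_trans (ler_coord_norm u k) _; rewrite lerDl.
by rewrite row_mxEr; apply: le_trans (ler_coord_norm v k) _; rewrite lerDr.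
Qed.

(** The filter [f @ F] is maximal because [F] contains the preimage of every set
    or of its complement. *)
Lemma ultra_fmap (T U : Type) (f : T -> U) (F : set_system T) :
  UltraFilter F -> UltraFilter (f @ F).
Proof.
move=> FU; have FP : ProperFilter F by exact: ultra_proper.
apply: Build_UltraFilter => H HP FH.
rewrite eqEsubset; split => // A HA.
have [//|FA] := in_ultra_setVsetC (f @^-1` A) FU.
have : H (~` A) by apply: FH.
move=> /(filterI HA); rewrite setICr => /(@filter_ex _ _ HP)[x []].
Qed.

Section LocalGroup.
Context {R : realType} {n : nat} {G : lieGroupType R n}.
Implicit Types (g h : G) (v w y : 'rV[R]_n).

Local Notation phi := (chart (1%g : G)).
Local Notation psi := (chartV (1%g : G)).
Local Notation x0 := (phi (1%g : G)).
Local Notation z0 := (row_mx x0 x0).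
Local Notation dom := (chart_dom (1%g : G)).
Local Notation im := (phi @` dom).
Local Notation mu := (mul_in_charts (1%g : G) (1%g : G) (1%g : G)).

Lemma dom1 : dom 1%g. Proof. exact: chart_dom_center. Qed.
Lemma im1 : im x0. Proof. by exists 1%g => //; exact: dom1. Qed.
Lemma psi1 : psi x0 = 1%g. Proof. by rewrite chartK//; exact: dom1. Qed.
Lemma phiK y : im y -> phi (psi y) = y.
Proof. by move=> [x px <-]; rewrite chartK. Qed.
Lemma dom_psi y : im y -> dom (psi y).
Proof. by move=> [x px <-]; rewrite chartK. Qed.
Lemma im_nbhs y : im y -> nbhs y im.
Proof. by move=> iy; apply: open_nbhs_nbhs; split => //; exact: chart_image_open. Qed.

Definition mul_dom : set 'rV[R]_(n + n) :=
  [set row_mx (phi z.1) (phi z.2) | z in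
     [set z : G * G | [/\ dom z.1, dom z.2 & dom (z.1 * z.2)%g]]].

(** In this form the domain is visibly a neighbourhood of [z0], by continuity
    of the operations ([mul_dom_near]). *)
Lemma mul_domP y z : mul_dom (row_mx y z) <-> [/\ im y, im z & dom (psi y * psi z)%g].
Proof.
split=> [[[x x'] /= [xd xd' xxd] /eq_row_mx[<- <-]]|[[x xd <-] [x' xd' <-]]].
  by split; [exists x|exists x'|rewrite !chartK].
by rewrite !chartK// => H; exists (x, x').
Qed.

Lemma mul_dom_near : \forall z \near z0, mul_dom z.
Proof.
have lc : {for z0, continuous (lsubmx : 'rV[R]_(n + n) -> 'rV[R]_n)}.
  exact/differentiable_continuous/differentiable_lsubmx.
have rc : {for z0, continuous (rsubmx : 'rV[R]_(n + n) -> 'rV[R]_n)}.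
  exact/differentiable_continuous/differentiable_rsubmx.
have lz : lsubmx z0 = x0 by rewrite row_mxKl.
have rz : rsubmx z0 = x0 by rewrite row_mxKr.
near=> z.
rewrite -(hsubmxK z); apply/mul_domP; split.
- by near: z; apply: lc; rewrite lz; exact: im_nbhs im1.
- by near: z; apply: rc; rewrite rz; exact: im_nbhs im1.
near: z; apply: (@chart_dom_near _ _ _ _ (fun z => (psi (lsubmx z) * psi (rsubmx z))%g)).
  apply: mulg_continuous.
    by apply: continuous_comp => //; rewrite lz; exact: chartV_continuous im1.
  by apply: continuous_comp => //; rewrite rz; exact: chartV_continuous im1.
by rewrite lz rz psi1 mulg1; exact: dom1.
Unshelve. all: by end_near. Qed.

Lemma mu_differentiable z : mul_dom z -> differentiable mu z.
Proof. by have [+ _] := (@mulg_smooth R n G).2 1%g 1%g 1%g 1; apply. Qed.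

Lemma dmu_continuous (w : 'rV[R]_(n + n)) z : mul_dom z -> {for z, continuous (fun z => 'd mu z w)}.
Proof. by have [_ +] := (@mulg_smooth R n G).2 1%g 1%g 1%g 1 => /(_ w); apply. Qed.

Lemma dmu_differentiable (w : 'rV[R]_(n + n)) z :
  mul_dom z -> differentiable (fun z => 'd mu z w) z.
Proof.
by have [_ /(_ w)[+ _]] := (@mulg_smooth R n G).2 1%g 1%g 1%g 2; apply.
Qed.

Lemma mul_dom0 : mul_dom z0. Proof. exact: (nbhs_singleton mul_dom_near). Qed.

Lemma tangent_map_mulg1 g v : tangent_map (fun h : G => (h * 1)%g) g v = v.
Proof.
have [c <- cv] := velocity_curve g v.
have := has_velocity_mulr 1%g cv.
have -> : (fun s => (c s * 1)%g) = c by apply/funext => s; rewrite mulg1.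
by move=> /(has_velocity_unique cv).
Qed.

Lemma tangent_map_mul1g g v : tangent_map (fun h : G => (1 * h)%g) g v = v.
Proof.
have [c <- cv] := velocity_curve g v.
have := has_velocity_mull 1%g cv.
have -> : (fun s => (1 * c s)%g) = c by apply/funext => s; rewrite mul1g.
by move=> /(has_velocity_unique cv).
Qed.

(** Multiplication by the identity is the identity map. *)
Lemma dmu_inl v : 'd mu z0 (inl_mx v) = v.
Proof.
have d11 : dom (1 * 1)%g by rewrite mulg1; exact: dom1.
rewrite -(diff_mulgr dom1 dom1 d11) -[RHS](tangent_map_mulg1 1%g).
by rewrite /tangent_map mulg1.
Qed.

Lemma mu1y y : im y -> mu (row_mx x0 y) = y.
Proof. by move=> iy; rewrite /mul_in_charts row_mxKl row_mxKr psi1 mul1g phiK. Qed.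

(** The function of [h] on the left vanishes at 0, and its derivative
    ['d mu (x0 + h v, y) (v, 0) - v] is small near [(x0, x0)], where it vanishes. *)
Lemma step_estimate v (e : R) : 0 < e -> exists2 d : R, 0 < d &
  forall (h : R) y, 0 <= h < d -> `|y - x0| < d ->
    mul_dom (row_mx (x0 + h *: v) y) /\
    `|mu (row_mx (x0 + h *: v) y) - y - h *: v| <= e * h.
Proof.
move=> e0.
have : \forall z \near z0, mul_dom z /\ `|'d mu z (inl_mx v) - v| <= e.
  apply: filterI; first exact: mul_dom_near.
  have dv : (fun z => 'd mu z (inl_mx v)) @ z0 --> v.
    exact: (eq_ind _ (fun u => _ @ z0 --> u) (dmu_continuous mul_dom0) _ (dmu_inl v)).
  move: dv => /cvgrPdist_le /(_ e e0).
  by apply: filterS => z; rewrite distrC.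
move=> /nbhs_normP[r /= r0 Hr].
(* [h |v| + |y - x0| < r] is needed when [h] and [|y - x0|] are below [d]. *)
pose d := r / (`|v| + 2).
have v2 : 0 < `|v| + 2 by rewrite ltr_wpDl.
have d0 : 0 < d by rewrite divr_gt0.
exists d => // h y /andP[h0 hd] yd.
have near s : 0 <= s <= h -> mul_dom (row_mx (x0 + s *: v) y) /\
     `|'d mu (row_mx (x0 + s *: v) y) (inl_mx v) - v| <= e.
  move=> /andP[s0 sh]; apply: Hr => /=.
  rewrite opp_row_mx add_row_mx opprD addrA subrr add0r -normrN opp_row_mx opprK opprB.
  apply: le_lt_trans (ler_norm_row_mx _ _) _.
  rewrite normrZ ger0_norm//.
  have : s * `|v| <= d * `|v| by rewrite ler_wpM2r// (le_trans sh)// ltW.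
  have : d * (`|v| + 2) = r by rewrite /d divfK// gt_eqF.
  move: yd d0; rewrite mulrDr; lra.
have hh : 0 <= h <= h by rewrite h0 lexx.
have hh0 : 0 <= (0 : R) <= h by rewrite h0 lexx.
split; first exact: (near h hh).1.
have iy : im y.
  by have := (near 0 hh0).1; rewrite scale0r addr0 => /mul_domP[].
have := @mean_value_le R n (fun s => mu (row_mx (x0 + s *: v) y))
   (fun s => 'd mu (row_mx (x0 + s *: v) y) (inl_mx v)) 0 h v e h0 (ltW e0).
rewrite scale0r addr0 mu1y// subr0; apply=> s sh; last exact: (near s sh).2.
have := is_derive_comp (is_derive_row_mx (is_derive_line x0 v s) (is_derive_cst y s 1))
  (mu_differentiable (near s sh).1).
by rewrite inl_mxE.
Qed.

Definition step v (h : R) : G := psi (x0 + h *: v).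

(** By induction on [j], each factor adds [h v] up to an error [e h], as long
    as the power has not left the ball where [step_estimate] applies; the bound on
    [j h] is chosen for this to hold. *)
Lemma power_estimate v (e : R) : 0 < e -> exists2 d : R, 0 < d &
  (forall y, `|y - x0| <= (`|v| + e) * d -> im y) /\
  forall (h : R) (j : nat), 0 < h < d -> j%:R * h <= d ->
    dom (step v h ^+ j)%g /\
    `|phi (step v h ^+ j)%g - x0 - (j%:R * h) *: v| <= e * (j%:R * h).
Proof.
move=> e0; have [r r0 Hr] := step_estimate v e0.
(* The polygon moves by at most [(|v| + e) j h], which must remain below [r]. *)
pose d := r / (`|v| + e + 1).
have v1 : 0 < `|v| + e + 1 by rewrite ltr_wpDl// addr_ge0// ltW.
have d0 : 0 < d by rewrite divr_gt0.
have dr : (`|v| + e) * d < r.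
  have : d * (`|v| + e + 1) = r by rewrite /d divfK// gt_eqF.
  move: d0; rewrite mulrDr mulr1 mulrC; lra.
have dr' : d <= r.
  rewrite /d ler_pdivrMr// ler_peMr ?(ltW r0)// lerDr addr_ge0// ltW //.
exists d => //; split=> [y yd|h j /andP[h0 hd]].
  have r00 : 0 <= (0:R) < r by rewrite lexx r0.
  have [+ _] := Hr 0 y r00 (le_lt_trans yd dr).
  by rewrite scale0r addr0 => /mul_domP[].
have hr : 0 <= h < r by rewrite ltW//= (lt_le_trans hd).
elim: j => [_|j IH jh].
  rewrite expg0 mul0r scale0r subr0 subrr normr0 mulr0; split => //; exact: dom1.
have jh' : j%:R * h <= d.
  by apply: le_trans jh; rewrite ler_wpM2r ?(ltW h0)// ler_nat.
have [gd ge] := IH jh'; set g := (step v h ^+ j)%g in gd ge *.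
have gr : `|phi g - x0| < r.
  apply: le_lt_trans dr.
  rewrite -[phi g - x0](subrK ((j%:R * h) *: v)).
  apply: le_trans (ler_normD _ _) _.
  rewrite normrZ ger0_norm ?mulr_ge0 ?(ltW h0)//.
  apply: (@le_trans _ _ ((`|v| + e) * (j%:R * h))).
    by move: ge; rewrite mulrDl [`|v| * _]mulrC; lra.
  by rewrite ler_wpM2l// addr_ge0// ltW.
have [md me] := Hr h (phi g) hr gr.
have gE : mu (row_mx (x0 + h *: v) (phi g)) = phi (step v h * g)%g.
  by rewrite /mul_in_charts row_mxKl row_mxKr chartK.
rewrite expgS -/g; split.
  by move: md => /mul_domP[_ _]; rewrite chartK.
rewrite -gE.
have split_diff (a b c p q : 'rV[R]_n) : a - c - (p + q) = (a - b - p) + (b - c - q).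
  by apply/rowP => i; rewrite !mxE; ring.
rewrite -natr1 mulrDl mul1r [j%:R * h + h]addrC scalerDl (split_diff _ (phi g)).
apply: le_trans (ler_normD _ _) _; apply: le_trans (lerD me ge) _.
by rewrite -mulrDr.
Qed.

End LocalGroup.

(** * One-parameter semigroups as limits of Euler polygons *)

Section OneParameter.
Context {R : realType} {n : nat} {G : lieGroupType R n}.
Implicit Types (g h : G) (v w y : 'rV[R]_n).

Local Notation phi := (chart (1%g : G)).
Local Notation psi := (chartV (1%g : G)).
Local Notation x0 := (phi (1%g : G)).
Local Notation dom := (chart_dom (1%g : G)).
Local Notation im := (phi @` dom).

Lemma chart_ball_compact (r : R) : (forall y, `|y - x0| <= r -> im y) ->
  compact (psi @` [set y | `|y - x0| <= r]).
Proof.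
move=> rim; apply: continuous_compact.
  apply: continuous_in_subspaceT => y; rewrite inE /= => /rim.
  exact: chartV_continuous.
have -> : [set y | `|y - x0| <= r] = closed_ball_ Num.norm x0 r.
  by apply/seteqP; split => y /=; rewrite distrC.
apply: bounded_closed_compact; last exact: closed_closed_ball_.
exists (`|x0| + `|r|); split; first exact: num_real.
move=> M xM y /= yr; apply: le_trans (ltW xM).
rewrite -[y](subrK x0) addrC (le_trans (ler_normD _ _))// lerD2l.
by rewrite distrC (le_trans yr)// ler_norm.
Qed.

(** Shifting [N] by one avoids a division by zero. *)
Definition mesh (N : nat) : R := N.+1%:R^-1.
Definition grid (t : R) (N : nat) : nat := Num.truncn (t * N.+1%:R).

Lemma mesh_gt0 N : 0 < mesh N. Proof. by rewrite /mesh invr_gt0. Qed.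

Lemma mesh_near (d : R) : 0 < d -> \forall N \near \oo, mesh N < d.
Proof. by move=> d0; exact: (near_infty_natSinv_lt (PosNum d0)). Qed.

Lemma grid_itv t N : 0 <= t ->
  (grid t N)%:R * mesh N <= t < (grid t N)%:R * mesh N + mesh N.
Proof.
move=> t0; have /truncn_itv : 0 <= t * N.+1%:R by rewrite mulr_ge0.
rewrite -/(grid t N) => /andP[H1 H2]; apply/andP; split.
  by rewrite /mesh ler_pdivrMr.
by rewrite -[X in _ + X]mul1r -mulrDl natr1 /mesh ltr_pdivlMr.
Qed.

Lemma grid_add s t N : 0 <= s -> 0 <= t ->
  grid (s + t) N = (grid s N + grid t N)%N \/
  grid (s + t) N = (grid s N + grid t N).+1.
Proof.
move=> s0 t0; have st0 : 0 <= s + t by rewrite addr_ge0.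
have /truncn_itv/andP[s1 s2] : 0 <= s * N.+1%:R by rewrite mulr_ge0.
have /truncn_itv/andP[t1 t2] : 0 <= t * N.+1%:R by rewrite mulr_ge0.
rewrite -/(grid s N) in s1 s2; rewrite -/(grid t N) in t1 t2.
rewrite /grid mulrDl -/(grid s N) -/(grid t N).
case: (ltP (s * N.+1%:R + t * N.+1%:R) (grid s N + grid t N).+1%:R) => H.
  by left; apply: truncn_def; rewrite H natrD lerD.
right; apply: truncn_def; rewrite H/=.
by rewrite -addnS -addSn natrD ltrD.
Qed.

Lemma grid_cvg t : 0 <= t -> (grid t N)%:R * mesh N @[N --> \oo] --> t.
Proof.
move=> t0; apply/cvgrPdist_le => e e0.
apply: filterS (mesh_near e0) => N Ne.
have /andP[a b] := grid_itv N t0.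
by rewrite ger0_norm ?subr_ge0//; lra.
Qed.

Definition euler v (t : R) (N : nat) : G := (step v (mesh N) ^+ grid t N)%g.

Lemma step_mesh_cvg v : (step v (mesh N) : G) @[N --> \oo] --> (1%g : G).
Proof.
have H : x0 + mesh N *: v @[N --> \oo] --> x0.
  rewrite -[X in _ --> X](addr0 x0) -(scale0r v).
  apply: cvgD; first exact: cvg_cst.
  apply: cvgZr_tmp; apply/cvgrPdist_le => e e0.
  apply: filterS (mesh_near e0) => N Ne.
  by rewrite sub0r normrN ger0_norm ltW// mesh_gt0.
rewrite -[X in _ --> X]psi1; apply: cvg_comp H _.
exact: chartV_continuous im1.
Qed.

Section Limit.
Context (v : 'rV[R]_n) (F : set_system nat) (FU : UltraFilter F) (Foo : \oo `<=` F).

Let FP : ProperFilter F := @ultra_proper _ _ FU.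

Lemma euler_estimate (e : R) : 0 < e -> exists2 d : R, 0 < d &
  (forall y, `|y - x0| <= (`|v| + e) * d -> im y) /\
  forall t, 0 <= t <= d -> F [set N | dom (euler v t N) /\
    `|phi (euler v t N) - x0 - ((grid t N)%:R * mesh N) *: v| <= e * t].
Proof.
move=> e0; have [d d0 [imd H]] := @power_estimate R n G v e e0.
exists d => //; split => // t /andP[t0 td].
apply: Foo; apply: filterS (mesh_near d0) => N Nd /=.
have /andP[tN _] := grid_itv N t0.
have mN : 0 < mesh N < d by rewrite mesh_gt0.
have [D E] := H (mesh N) (grid t N) mN (le_trans tN td).
by split => //; rewrite (le_trans E)// ler_wpM2l// ltW.
Qed.

Lemma euler_in_ball (e d t : R) : 0 < e -> 0 <= t <= d ->
  F [set N | dom (euler v t N) /\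
    `|phi (euler v t N) - x0 - ((grid t N)%:R * mesh N) *: v| <= e * t] ->
  F [set N | (psi @` [set y | `|y - x0| <= (`|v| + e) * d]) (euler v t N)].
Proof.
move=> e0 /andP[t0 td]; apply: filterS => N [D E].
exists (phi (euler v t N)); last by rewrite chartK.
have /andP[tN _] := grid_itv N t0.
rewrite /= -[phi _ - x0](subrK (((grid t N)%:R * mesh N) *: v)).
apply: le_trans (ler_normD _ _) _.
rewrite normrZ ger0_norm ?mulr_ge0 ?(ltW (mesh_gt0 _))//.
have : (grid t N)%:R * mesh N * `|v| <= d * `|v| by rewrite ler_wpM2r// (le_trans tN).
have : e * t <= e * d by rewrite ler_wpM2l// ltW.
by move: E; rewrite mulrDl [`|v| * d]mulrC; lra.
Qed.

(** An ultrafilter converges in a compact set, here a ball of the chart. *)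
Lemma euler_cvg_small : exists2 d : R, 0 < d &
  forall t, 0 <= t <= d -> exists g : G, euler v t @ F --> g.
Proof.
have [d d0 [imd H]] := euler_estimate ltr01; exists d => // t td.
have := chart_ball_compact imd; rewrite compact_ultra.
have := euler_in_ball ltr01 td (H t td).
move=> FK /(_ (euler v t @ F) (ultra_fmap _ FU) FK)[g [_ gl]].
by exists g.
Qed.

(** The exponents [grid s N + grid t N] and [grid (s + t) N] differ by at most
    one factor [step v (mesh N)], which tends to the identity. *)
Lemma euler_cvg_add s t g h : 0 <= s -> 0 <= t ->
  euler v s @ F --> g -> euler v t @ F --> h -> euler v (s + t) @ F --> (g * h)%g.
Proof.
move=> s0 t0 sg th.
have mulc (a b : nat -> G) (x y : G) : a @ F --> x -> b @ F --> y ->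
    (fun N => (a N * b N)%g) @ F --> (x * y)%g.
  move=> ax bY; apply: (@continuous2_cvg nat G G G F _ a b (fun p q => (p * q)%g)) => //.
  by have K := (@mulg_smooth R n G).1 (x, y); exact: K.
(* The factor by which the two sides differ. *)
pose r N : G := if grid (s + t) N == (grid s N + grid t N)%N then 1%g else step v (mesh N).
have r1 : r @ F --> (1%g : G).
  move=> A A1; have : F [set N | A (step v (mesh N))].
    by apply: Foo; exact: step_mesh_cvg A1.
  apply: (@filterS _ F _) => N AN; rewrite /= /r; case: ifP => // _.
  exact: nbhs_singleton A1.
have := mulc _ _ _ _ (mulc _ _ _ _ sg th) r1; rewrite mulg1.
apply: cvg_trans; apply: near_eq_cvg; apply: nearW => N.
rewrite /r /euler -expgnDr; case: (grid_add N s0 t0) => ->.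
  by rewrite eqxx mulg1.
by rewrite gtn_eqF// expgSr.
Qed.

(** Large times are sums of small ones. *)
Lemma euler_cvg t : 0 <= t -> exists g : G, euler v t @ F --> g.
Proof.
have [d d0 H] := euler_cvg_small.
have K (k : nat) : forall t, 0 <= t <= d *+ k.+1 -> exists g : G, euler v t @ F --> g.
  elim: k => [|k IH] s; first by rewrite mulr1n; exact: H.
  move=> /andP[s0 sd].
  case: (leP s d) => [sd'|ds]; first by apply: H; rewrite s0.
  have [g gl] : exists g : G, euler v (s - d) @ F --> g.
    by apply: IH; move: sd; rewrite mulrS; lra.
  have [h hl] : exists g : G, euler v d @ F --> g by apply: H; rewrite lexx ltW.
  exists (g * h)%g; rewrite -(subrK d s); apply: euler_cvg_add => //; lra.
move=> t0; apply: (K (Num.truncn (t / d))); rewrite t0/=.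
have /truncn_itv/andP[_] : 0 <= t / d by rewrite divr_ge0// ltW.
by rewrite ltr_pdivrMr// mulr_natl => /ltW.
Qed.

End Limit.

(** The limits are unique because the manifold is Hausdorff; they
    remain in the domain of the chart because the balls that contain the polygons are
    compact, hence closed, and the estimates then pass to them by continuity. *)
Lemma one_parameter_semigroup v : exists a : R -> G,
  [/\ a 0 = 1%g, forall s t, 0 <= s -> 0 <= t -> a (s + t) = (a s * a t)%g &
   forall e : R, 0 < e -> exists2 d : R, 0 < d & forall t, 0 <= t <= d ->
     dom (a t) /\ `|phi (a t) - x0 - t *: v| <= e * t].
Proof.
have [F [FU Foo]] := @ultraFilterLemma nat (\oo : set_system nat) _.
have FP : ProperFilter F := @ultra_proper _ _ FU.
have [a aP] : exists a : R -> G, forall t, 0 <= t -> euler v t @ F --> a t.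
  have /choice[a aP] : forall t, exists g : G, 0 <= t -> euler v t @ F --> g.
    move=> t; case: (leP 0 t) => [t0|_]; last by exists 1%g.
    by have [g gl] := euler_cvg v FU Foo t0; exists g.
  by exists a.
have uniq (u : nat -> G) (x y : G) : u @ F --> x -> u @ F --> y -> x = y.
  move=> ux uy; have := @cvg_unique G (@manifold_hausdorff R n G) (u @ F) _ x y; exact.
exists a; split.
- apply: uniq (aP 0 (lexx _)) _.
  have -> : euler v 0 = fun=> (1%g : G); last exact: cvg_cst.
  by apply/funext => N; rewrite /euler /grid mul0r truncn0 expg0.
- move=> s t s0 t0; apply: uniq (aP _ (addr_ge0 s0 t0)) _.
  by apply: euler_cvg_add => //; exact: aP.
move=> e e0; have [d d0 [imd H]] := euler_estimate v Foo e0.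
exists d => // t td; have t0 : 0 <= t by move/andP: td => [].
have Ed := H t td; have EK := euler_in_ball FU e0 td Ed.
have Kc := compact_closed (@manifold_hausdorff R n G) (chart_ball_compact imd).
have [y /imd iy yE] := closed_cvg _ Kc EK _ (aP t t0).
have aD : dom (a t) by rewrite -yE; exact: dom_psi.
split => //.
have lim : phi (euler v t N) - x0 - ((grid t N)%:R * mesh N) *: v @[N --> F] -->
    phi (a t) - x0 - t *: v.
  apply: cvgB; last first.
    by apply: cvgZr_tmp; apply: cvg_trans (grid_cvg t0); exact: cvg_app.
  apply: cvgB; last exact: cvg_cst.
  by apply: cvg_comp (aP t t0) _; exact: chart_continuous aD.
have cB : closed (closed_ball_ Num.norm (0 : 'rV[R]_n) (e * t)) by exact: closed_closed_ball_.
suff : closed_ball_ Num.norm (0 : 'rV[R]_n) (e * t) (phi (a t) - x0 - t *: v).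
  by rewrite /closed_ball_ /= sub0r normrN.
apply: (closed_cvg _ cB _ _ lim).
by apply: filterS Ed => N [_]; rewrite /closed_ball_ /= sub0r normrN.
Qed.

End OneParameter.

(** * The exponential curves of right invariant vector fields *)

Section ExpCurve.
Context {R : realType} {n : nat} {G : lieGroupType R n}.
Implicit Types (g : G) (v w : 'rV[R]_n) (a b c : R -> G).

Local Notation phi := (chart (1%g : G)).
Local Notation psi := (chartV (1%g : G)).
Local Notation x0 := (phi (1%g : G)).
Local Notation dom := (chart_dom (1%g : G)).
Local Notation im := (phi @` dom).

(** The product of a curve and its inverse is constant. *)
Lemma tangent_map_inv1 v : tangent_map (fun h : G => h^-1%g) 1%g v = - v.
Proof.
have [c c0 cv] := velocity_curve (1%g : G) v.
have := has_velocity_mul cv (has_velocity_inv cv).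
rewrite c0 invg1 tangent_map_mulg1 tangent_map_mul1g.
have -> : (fun s => (c s * (c s)^-1)%g) = fun=> 1%g.
  by apply/funext => s; rewrite mulgV.
move=> /(has_velocity_unique (has_velocity_cst _ _))/esym/eqP.
by rewrite addrC addr_eq0 => /eqP.
Qed.

Lemma inv_chart_estimate (e : R) : 0 < e -> exists2 d : R, 0 < d &
  forall g, dom g -> `|phi g - x0| < d -> dom (g^-1)%g /\
    `|phi (g^-1)%g - x0 + (phi g - x0)| <= e * `|phi g - x0|.
Proof.
move=> e0.
have d1 : dom (1^-1)%g by rewrite invg1; exact: dom1.
have D := smooth_map_differentiable (@invg_smooth R n G) dom1 d1.
have [d dd H] := diff_eps D e0.
have : \forall y \near x0, dom (psi y)^-1%g.
  apply: (@chart_dom_near _ _ _ _ (fun y => (psi y)^-1%g)); last first.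
    by rewrite psi1 invg1; exact: dom1.
  apply: continuous_comp; first exact: chartV_continuous im1.
  exact: (@invg_smooth R n G).1.
move=> /nbhs_normP[r /= r0 Hr].
exists (Num.min r d); first by rewrite lt_min r0.
move=> g gd; rewrite lt_min => /andP[gr gd'].
split; first by have := Hr (phi g); rewrite /= distrC chartK//; apply.
have := H _ gd'; rewrite [x0 + _]addrC subrK /= (chartK _ _ gd) psi1 invg1.
have -> : 'd (phi \o (fun g => g^-1)%g \o psi) x0 (phi g - x0) = - (phi g - x0).
  by rewrite -[RHS]tangent_map_inv1 /tangent_map invg1.
by rewrite opprK.
Qed.

Lemma has_velocity_eps a v : a 0 = 1%g ->
  (forall e : R, 0 < e -> exists2 d : R, 0 < d & forall h, `|h| < d ->
    dom (a h) /\ `|phi (a h) - x0 - h *: v| <= e * `|h|) ->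
  has_velocity a 0 v.
Proof.
move=> a0 H.
have D : is_derive 0 (1 : R) (fun s => phi (a s)) v.
  apply: eps_is_derive => e /H[d d0 K]; exists d => // h hd.
  by rewrite add0r a0; exact: (K h hd).2.
have [d d0 K] := H 1 ltr01.
have nd : \forall s \near (0 : R), dom (a s).
  apply/nbhs_normP; exists d => //= s; rewrite /= sub0r normrN => sd.
  exact: (K s sd).1.
split; last by rewrite a0.
have c1 : {for 0, continuous (psi \o (fun s => phi (a s)))}.
  apply: continuous_comp.
    by apply: differentiable_continuous; apply/derivable1_diffP; exact: ex_derive.
  by rewrite a0; exact: chartV_continuous im1.
have near_a : \forall s \near (0 : R), (psi \o (fun s => phi (a s))) s = a s.
  by apply: filterS nd => s sd; rewrite /= chartK.
have c2 : (psi \o (fun s => phi (a s))) s @[s --> (0 : R)] --> a 0.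
  exact: (eq_ind _ (fun u => _ --> u) c1 _ (nbhs_singleton near_a)).
by apply: cvg_trans c2; exact: near_eq_cvg.
Qed.

(** The semigroup is extended to negative times by inversion.  Its derivative at
    0 from the left is the one from the right, because inversion has differential
    [- id] at the identity. *)
Lemma one_parameter_exists v : exists2 a : R -> G,
  (forall s t, a (s + t) = (a s * a t)%g) & has_velocity a 0 v.
Proof.
have [a [a0 aD aE]] := one_parameter_semigroup (G := G) v.
have aC s t : 0 <= s -> 0 <= t -> (a s * a t = a t * a s)%g.
  by move=> s0 t0; rewrite -aD// addrC aD.
have aB s t : 0 <= t -> t <= s -> a (s - t) = (a s * (a t)^-1)%g.
  move=> t0 ts; have -> : a s = (a (s - t) * a t)%g by rewrite -aD ?subr_ge0// subrK.
  by rewrite -mulgA mulgV mulg1.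
have aB' s t : 0 <= t -> t <= s -> a (s - t) = ((a t)^-1 * a s)%g.
  move=> t0 ts; have -> : a s = (a t * a (s - t))%g by rewrite -aD ?subr_ge0// addrC subrK.
  by rewrite mulgA mulVg mul1g.
pose A (t : R) := if 0 <= t then a t else (a (- t))^-1%g.
exists A => [s t|].
  rewrite /A; case: (leP 0 s) => s0; case: (leP 0 t) => t0.
  - by rewrite addr_ge0// aD.
  - case: (leP 0 (s + t)) => st.
      by rewrite -aB ?opprK//; lra.
    have -> : - (s + t) = - t - s by ring.
    rewrite aB ?invgM ?invgK//; lra.
  - case: (leP 0 (s + t)) => st.
      have -> : s + t = t - - s by ring.
      rewrite aB' //; lra.
    rewrite opprD aB' ?invgM ?invgK//; lra.
  - have -> : (0 <= s + t) = false by apply/negbTE; rewrite -ltNge; lra.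
    rewrite -invgM -aD ?[- t - s]addrC ?opprD//; lra.
apply: has_velocity_eps => [|e e0]; first by rewrite /A lexx.
have e1 : 0 < Num.min 1 (e / 2) by rewrite lt_min ltr01 divr_gt0.
have e2 : 0 < e / (2 * (`|v| + 1)) by rewrite divr_gt0// mulr_gt0// ltr_wpDl.
have [d1 d10 H1] := aE _ e1.
have [d2 d20 H2] := inv_chart_estimate e2.
exists (Num.min d1 (d2 / (`|v| + 1))).
  by rewrite lt_min d10 divr_gt0// ltr_wpDl.
move=> h; rewrite lt_min ltr_pdivlMr ?ltr_wpDl// => /andP[hd1 hd2].
have hh : 0 <= `|h| <= d1 by rewrite normr_ge0 ltW.
have [aD' aH] := H1 _ hh.
have le1 : Num.min 1 (e / 2) <= 1 by rewrite ge_min lexx.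
have le2 : Num.min 1 (e / 2) <= e / 2 by rewrite ge_min lexx orbT.
rewrite /A; case: (leP 0 h) => h0.
  rewrite ger0_norm// in aD' aH *; split => //; apply: le_trans aH _.
  by rewrite ler_wpM2r//; lra.
have hE : `|h| = - h by rewrite ltr0_norm.
rewrite -hE; set g := a `|h| in aD' aH *.
have gn : `|phi g - x0| <= (`|v| + 1) * `|h|.
  rewrite -[phi g - x0](subrK (`|h| *: v)).
  apply: le_trans (ler_normD _ _) _; rewrite normrZ normr_id mulrDl mul1r addrC.
  by rewrite [`|h| * _]mulrC lerD2l; apply: le_trans aH _; rewrite ler_piMl.
have [gD gH] : dom (g^-1)%g /\
    `|phi (g^-1)%g - x0 + (phi g - x0)| <= e / (2 * (`|v| + 1)) * `|phi g - x0|.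
  by apply: H2 => //; apply: le_lt_trans gn _; rewrite mulrC.
split => //.
have split_diff (p q r : 'rV[R]_n) : p - q - h *: v = (p - q + (r - q)) - (r - q - (- h) *: v).
  by apply/rowP => i; rewrite !mxE; ring.
rewrite (split_diff _ _ (phi g)) -hE.
apply: le_trans (ler_normB _ _) _.
have -> : e * `|h| = e / (2 * (`|v| + 1)) * ((`|v| + 1) * `|h|) + e / 2 * `|h|.
  have v0 : `|v| + 1 != 0 by rewrite gt_eqF// ltr_wpDl.
  by field.
apply: lerD.
  by apply: le_trans gH _; rewrite ler_wpM2l// ltW.
by apply: le_trans aH _; rewrite ler_wpM2r.
Qed.

(** Near [t], the homomorphism [a] is the translate by [a t] of its restriction
    to a neighbourhood of 0. *)
Lemma hom_integral_curve (X : vfield G) a : translation_invariant X ->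
  (forall s t, a (s + t) = (a s * a t)%g) -> has_velocity a 0 (X 1%g) ->
  integral_curve X a.
Proof.
move=> Xi aD a0 t.
have E : a 0 = 1%g by apply: (mulgI (a 0)); rewrite -aD addr0 mulg1.
have H : has_velocity (fun s => a (1 * s - t)) t (X (a (1 * t - t))).
  rewrite -[X (a _)]scale1r; apply: has_velocity_reparam.
  by rewrite mul1r subrr E.
have := translate_curve (a t) Xi H.
have -> : (fun s => (a (1 * s - t) * a t)%g) = a.
  by apply/funext => s; rewrite mul1r -aD subrK.
by rewrite mul1r subrr E mul1g.
Qed.

(** The curve [t |-> exp (t X)]. *)
Definition exp_curve (X : vfield G) : R -> G :=
  xget (fun=> 1%g) [set a | (forall s t, a (s + t) = (a s * a t)%g) /\
                            integral_curve X a].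

Section Invariant.
Context (X : vfield G) (Xi : translation_invariant X).

Lemma exp_curveP : (forall s t, exp_curve X (s + t) = (exp_curve X s * exp_curve X t)%g) /\
  integral_curve X (exp_curve X).
Proof.
have [a aD a0] := one_parameter_exists (X 1%g).
have aX : integral_curve X a by exact: hom_integral_curve.
rewrite /exp_curve; case: xgetP => [c _ //|/(_ a)[]].
by split.
Qed.

Lemma exp_curveD s t : exp_curve X (s + t) = (exp_curve X s * exp_curve X t)%g.
Proof. exact: exp_curveP.1. Qed.

Lemma exp_curve0 : exp_curve X 0 = 1%g.
Proof. by apply: (mulgI (exp_curve X 0)); rewrite -exp_curveD addr0 mulg1. Qed.

Lemma exp_curve_velocity t : has_velocity (exp_curve X) t (X (exp_curve X t)).
Proof. exact: exp_curveP.2. Qed.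

Lemma lie_exp_scale t : lie_exp (fun g => t *: X g) = exp_curve X t.
Proof.
have tXi : translation_invariant (fun g => t *: X g).
  by move=> k g; rewrite Xi /tangent_map linearZ.
have tc : integral_curve (fun g => t *: X g) (fun s => exp_curve X (t * s + 0)).
  by move=> s; apply: has_velocity_reparam; exact: exp_curve_velocity.
have c0 : exp_curve X (t * 0 + 0) = 1%g by rewrite mulr0 addr0 exp_curve0.
rewrite /lie_exp; case: xgetP => [y _ [c [cX c1 <-]]|/(_ (exp_curve X (t * 1 + 0)))[]].
  rewrite (integral_curve_unique tXi cX tc); last by rewrite c1 c0.
  by rewrite mulr1 addr0.
by exists (fun s => exp_curve X (t * s + 0)).
Qed.

End Invariant.
End ExpCurve.

(** * Commuting vector fields have commuting exponentials *)

(** Convergence on a basis is convergence in operator norm, so that [L t] is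
    eventually within 1/2 of the identity. *)
Lemma near_id_lower_bound (R : realType) (n : nat) (T : Type) (F : set_system T)
  (FF : Filter F) (L : T -> {linear 'rV[R]_n -> 'rV[R]_n}) :
  (forall j, L t (delta_mx 0 j) @[t --> F] --> (delta_mx 0 j : 'rV[R]_n)) ->
  \forall t \near F, forall u, `|u| <= 2 * `|L t u|.
Proof.
move=> Le.
(* The [n] basis vectors each contribute at most [e |u|] to [|u - L t u|]. *)
pose e : R := 1 / (2 * n.+1%:R).
have e0 : 0 < e by rewrite divr_gt0// mulr_gt0// ltr0n.
have : \forall t \near F, forall j : 'I_n, `|delta_mx 0 j - L t (delta_mx 0 j)| <= e.
  apply: filter_forall => j; have /cvgrPdist_le := Le j; exact.
apply: filterS => t H u.
have : `|u - L t u| <= `|u| / 2.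
  rewrite {1 2}(row_sum_delta u) linear_sum -sumrB.
  apply: le_trans (ler_norm_sum _ _ _) _.
  apply: (@le_trans _ _ (\sum_(j < n) `|u| * e)).
    apply: ler_sum => j _; rewrite linearZ -scalerBr normrZ.
    by rewrite ler_pM ?ler_coord_norm.
  rewrite sumr_const card_ord -mulrnAr ler_wpM2l// -mulr_natr /e mul1r.
  by rewrite invfM -mulrA ler_piMr// ler_pdivrMl ?ltr0n// mulr1 ler_nat.
have := ler_normD (u - L t u) (L t u); rewrite subrK; lra.
Qed.

Section Commutation.
Context {R : realType} {n : nat} {G : lieGroupType R n}.
Implicit Types (g h : G) (u v w : 'rV[R]_n).

Local Notation phi := (chart (1%g : G)).
Local Notation psi := (chartV (1%g : G)).
Local Notation x0 := (phi (1%g : G)).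
Local Notation z0 := (row_mx x0 x0).
Local Notation dom := (chart_dom (1%g : G)).
Local Notation im := (phi @` dom).
Local Notation mu := (mul_in_charts (1%g : G) (1%g : G) (1%g : G)).

Definition dmu (z : 'rV[R]_(n + n)) : {linear 'rV[R]_(n + n) -> 'rV[R]_n} := 'd mu z.

(** The mixed second derivative of the multiplication at the identity, in the
    chart: first in the left variable along [u], then in the right variable along
    [w]. *)
Definition hess u w : 'rV[R]_n := 'd (fun z => dmu z (inl_mx u)) z0 (inr_mx w).

Lemma hess_linear_r u : linear (hess u).
Proof.
move=> k v w; rewrite /hess (linearP inr_mx); exact: linearP.
Qed.

Lemma hess_linear_l w : linear (hess^~ w).
Proof.
move=> k u v; rewrite /hess.
have du := dmu_differentiable (inl_mx u) (@mul_dom0 R n G).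
have dv := dmu_differentiable (inl_mx v) (@mul_dom0 R n G).
have -> : (fun z => dmu z (inl_mx (k *: u + v))) =
    k \*: (fun z => dmu z (inl_mx u)) + (fun z => dmu z (inl_mx v)).
  apply/funext => z.
  exact: (etrans (congr1 (dmu z) (linearP inl_mx k u v)) (linearP (dmu z) k _ _)).
exact: diff_linear_comb du dv.
Qed.

Lemma hess_sym u w : hess u w = 'd (fun z => dmu z (inr_mx w)) z0 (inl_mx u).
Proof.
apply: second_diff_sym.
- by apply: filterS (@mul_dom_near R n G) => z; exact: mu_differentiable.
- exact: (dmu_differentiable _ (@mul_dom0 R n G)).
- exact: (dmu_differentiable _ (@mul_dom0 R n G)).
Qed.

(** Right invariance says that [X q] is the image of [X 1] under the right
    translation by [q], i.e. a partial derivative of the multiplication. *)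
Lemma vf_in_chart_mu (X : vfield G) y : translation_invariant X -> im y ->
  vf_in_chart (1%g : G) X y = dmu (row_mx x0 y) (inl_mx (X 1%g)).
Proof.
move=> Xi iy; set q := psi y.
have qd : dom q := dom_psi iy.
have [c c0 cv] := velocity_curve (1%g : G) (X 1%g).
have cq : has_velocity (fun s => (c s * q)%g) 0 (X q).
  by have := translate_curve (X := X) (c := c) (t := 0) q Xi; rewrite c0 mul1g; apply.
have cq0 : (c 0 * q)%g = q by rewrite c0 mul1g.
have D1 : is_derive (0 : R) (1 : R) (fun s => phi (c s * q)%g) (vf_in_chart (1%g : G) X y).
  have := has_velocity_chart (p := 1%g) cq; rewrite cq0; exact.
have md : mul_dom (G := G) (row_mx x0 y).
  by apply/mul_domP; split => //; [exact: im1|rewrite psi1 mul1g].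
have c1 : is_derive (0 : R) (1 : R) (fun s => phi (c s)) (X 1%g) by case: cv => _; rewrite c0.
have m0 : differentiable mu (row_mx (phi (c 0)) y) by rewrite c0; exact: mu_differentiable.
have D2 := is_derive_comp (is_derive_row_mx c1 (is_derive_cst y (0 : R) (1 : R))) m0.
have E : \forall s \near (0 : R), (mu \o (fun s => row_mx (phi (c s)) y)) s = phi (c s * q)%g.
  have c0d : dom (c 0) by rewrite c0; exact: dom1.
  apply: filterS (chart_dom_near cv.1 c0d) => s sd.
  by rewrite /= /mul_in_charts row_mxKl row_mxKr chartK.
have D3 := near_eq_is_derive E D2.
rewrite -(@derive_val _ _ _ _ _ _ _ D1) (@derive_val _ _ _ _ _ _ _ D3) c0.
by rewrite inl_mxE.
Qed.

Lemma diff_vf_in_chart (X : vfield G) w : right_invariant X ->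
  'd (vf_in_chart (1%g : G) X) x0 w = hess (X 1%g) w.
Proof.
move=> [Xs Xi].
have Xd : differentiable (vf_in_chart (1%g : G) X) x0.
  by have [+ _] := Xs 1%g 1; apply; exact: im1.
have dm := dmu_differentiable (inl_mx (X 1%g)) (@mul_dom0 R n G).
have L := is_derive_line x0 w 0.
have x00 : x0 + 0 *: w = x0 by rewrite scale0r addr0.
have Xd' : differentiable (vf_in_chart (1%g : G) X) (x0 + 0 *: w) by rewrite x00.
have D1 := is_derive_comp L Xd'; rewrite x00 in D1.
have dm' : differentiable (fun z => dmu z (inl_mx (X 1%g))) (row_mx x0 (x0 + 0 *: w)).
  by rewrite x00.
have D2 := is_derive_comp (is_derive_row_mx (is_derive_cst x0 (0 : R) (1 : R)) L) dm'.
rewrite x00 in D2.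
have E : \forall s \near (0 : R),
   ((fun z => dmu z (inl_mx (X 1%g))) \o (fun s => row_mx x0 (x0 + s *: w))) s =
   (vf_in_chart (1%g : G) X \o (fun s => x0 + s *: w)) s.
  have Lc : {for 0, continuous (fun s : R => x0 + s *: w)}.
    by apply: differentiable_continuous; apply/derivable1_diffP; exact: ex_derive.
  have : \forall s \near (0 : R), im (x0 + s *: w).
    by apply: Lc; rewrite x00; exact: im_nbhs im1.
  by apply: filterS => s sd; rewrite /= vf_in_chart_mu.
have D3 := near_eq_is_derive E D2.
rewrite -(@derive_val _ _ _ _ _ _ _ D1) (@derive_val _ _ _ _ _ _ _ D3).
by rewrite /hess inr_mxE.
Qed.

Lemma lie_bracket1 (X Y : vfield G) : right_invariant X -> right_invariant Y ->
  lie_bracket X Y 1%g = hess (Y 1%g) (X 1%g) - hess (X 1%g) (Y 1%g).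
Proof.
by move=> Xi Yi; rewrite /lie_bracket; congr (_ - _); exact: diff_vf_in_chart.
Qed.

(** The differential at the identity of the conjugation by [g]. *)
Definition Ad g : 'rV[R]_n -> 'rV[R]_n := fun w =>
  tangent_map (fun h => (h * g^-1)%g) g (tangent_map (fun h => (g * h)%g) 1%g w).

Lemma has_velocity_conj g (c : R -> G) (t : R) w : c t = 1%g -> has_velocity c t w ->
  has_velocity (fun s => (g * c s * g^-1)%g) t (Ad g w).
Proof.
move=> c1 cw; have := has_velocity_mulr (g^-1)%g (has_velocity_mull g cw).
by rewrite c1 mulg1.
Qed.

Lemma Ad1 w : Ad 1%g w = w.
Proof.
have [c c0 cw] := velocity_curve (1%g : G) w.
apply: (has_velocity_unique (has_velocity_conj 1%g c0 cw)).
have -> // : (fun s => (1 * c s * 1^-1)%g) = c.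
by apply/funext => s; rewrite mul1g invg1 mulg1.
Qed.

Lemma AdM g h w : Ad (g * h)%g w = Ad g (Ad h w).
Proof.
have [c c0 cw] := velocity_curve (1%g : G) w.
apply: (has_velocity_unique (has_velocity_conj (g * h)%g c0 cw)).
have d0 : (h * c 0 * h^-1)%g = 1%g by rewrite c0 mulg1 mulgV.
have := has_velocity_conj g d0 (has_velocity_conj h c0 cw).
congr has_velocity; apply/funext => s.
by rewrite invgM !mulgA.
Qed.

Lemma Ad_is_derive g (f : R -> 'rV[R]_n) (t : R) v :
  is_derive t (1 : R) f v -> is_derive t (1 : R) (fun s => Ad g (f s)) (Ad g v).
Proof.
move=> fv; rewrite /Ad /tangent_map.
by apply: is_derive_linear; apply: is_derive_linear.
Qed.

(** Both sides are derivatives at 0 of [g * c s = (g * c s * g^-1) * g], for a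
    curve [c] with velocity [w] at the identity. *)
Lemma Ad_in_chart g w : dom g ->
  dmu (row_mx x0 (phi g)) (inl_mx (Ad g w)) = dmu (row_mx (phi g) x0) (inr_mx w).
Proof.
move=> gd.
have [c c0 cw] := velocity_curve (1%g : G) w.
have cg := has_velocity_conj g c0 cw.
have e0 : (g * c 0 * g^-1)%g = 1%g by rewrite c0 mulg1 mulgV.
have D1 : is_derive (0 : R) (1 : R) (fun s => phi (g * c s * g^-1)%g) (Ad g w).
  by case: cg => _; rewrite e0.
have D2 : is_derive (0 : R) (1 : R) (fun s => phi (c s)) w by case: cw => _; rewrite c0.
have m1 : mul_dom (G := G) (row_mx x0 (phi g)).
  by exists (1%g, g) => //; split => //=; rewrite ?mul1g//; exact: dom1.
have m2 : mul_dom (G := G) (row_mx (phi g) x0).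
  by exists (g, 1%g) => //; split => //=; rewrite ?mulg1//; exact: dom1.
have m1' : differentiable mu (row_mx (phi (g * c 0 * g^-1)%g) (phi g)).
  by rewrite e0; exact: mu_differentiable.
have m2' : differentiable mu (row_mx (phi g) (phi (c 0))).
  by rewrite c0; exact: mu_differentiable.
have D3 := is_derive_comp (is_derive_row_mx D1 (is_derive_cst (phi g) (0 : R) (1 : R))) m1'.
have D4 := is_derive_comp (is_derive_row_mx (is_derive_cst (phi g) (0 : R) (1 : R)) D2) m2'.
have E : \forall s \near (0 : R),
   (mu \o (fun s => row_mx (phi (g * c s * g^-1)%g) (phi g))) s =
   (mu \o (fun s => row_mx (phi g) (phi (c s)))) s.
  have e0d : dom (g * c 0 * g^-1)%g by rewrite e0; exact: dom1.
  have c0d : dom (c 0) by rewrite c0; exact: dom1.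
  apply: filterS2 (chart_dom_near cg.1 e0d) (chart_dom_near cw.1 c0d) => s sd1 sd2.
  rewrite /= /mul_in_charts !row_mxKl !row_mxKr !chartK//.
  by rewrite -!mulgA mulVg mulg1.
have D5 := near_eq_is_derive E D3.
have := etrans (esym (@derive_val _ _ _ _ _ _ _ D5)) (@derive_val _ _ _ _ _ _ _ D4).
by rewrite e0 c0 inl_mxE inr_mxE.
Qed.

(** Let [L s] be the differential of the right translation by [a s].  By
    [Ad_in_chart], [L s (Ad (a s) w - w)] is the difference of two partial
    derivatives of the multiplication, whose derivative at 0 is
    [hess v w - hess w v = 0].  As [L s] tends to the identity, it can be removed. *)
Lemma Ad_velocity0 (a : R -> G) v w : a 0 = 1%g -> has_velocity a 0 v ->
  hess v w = hess w v -> is_derive (0 : R) (1 : R) (fun s => Ad (a s) w) 0.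
Proof.
move=> a0 av vw.
have al : is_derive (0 : R) (1 : R) (fun s => phi (a s)) v by case: av => _; rewrite a0.
pose P s := dmu (row_mx (phi (a s)) x0) (inr_mx w).
pose Q s := dmu (row_mx x0 (phi (a s))) (inl_mx w).
have cx := is_derive_cst x0 (0 : R) (1 : R).
have dP' : differentiable (fun z => dmu z (inr_mx w)) (row_mx (phi (a 0)) x0).
  by rewrite a0; exact: (dmu_differentiable _ (@mul_dom0 R n G)).
have dQ' : differentiable (fun z => dmu z (inl_mx w)) (row_mx x0 (phi (a 0))).
  by rewrite a0; exact: (dmu_differentiable _ (@mul_dom0 R n G)).
have DP : is_derive (0 : R) (1 : R) P (hess v w).
  have D := is_derive_comp (is_derive_row_mx al cx) dP'.
  by rewrite a0 in D; rewrite hess_sym inl_mxE.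
have DQ : is_derive (0 : R) (1 : R) Q (hess w v).
  have D := is_derive_comp (is_derive_row_mx cx al) dQ'.
  by rewrite a0 in D; rewrite /hess inr_mxE.
have PQ0 : P 0 = Q 0.
  by rewrite /P /Q a0 -(Ad_in_chart w (@dom1 R n G)) Ad1.
have D : is_derive (0 : R) (1 : R) (P - Q) 0.
  by have := is_deriveB DP DQ; rewrite vw subrr.
have Dd : differentiable (P - Q) (0 : R) by apply/derivable1_diffP; exact: ex_derive.
have D0 k : 'd (P - Q) (0 : R) k = 0.
  by rewrite -[k]mulr1 linearZ/= -deriveE// (@derive_val _ _ _ _ _ _ _ D) scaler0.
pose L s : {linear 'rV[R]_n -> 'rV[R]_n} := dmu (row_mx x0 (phi (a s))) \o inl_mx.
have Lnear : \forall s \near (0 : R), forall u, `|u| <= 2 * `|L s u|.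
  apply: (@near_id_lower_bound _ _ _ (nbhs (0 : R)) _ L) => j.
  have Hc : {for 0, continuous (fun s => dmu (row_mx x0 (phi (a s))) (inl_mx (delta_mx 0 j)))}.
    apply: differentiable_continuous; apply/derivable1_diffP.
    have dj : differentiable (fun z => dmu z (inl_mx (delta_mx 0 j))) (row_mx x0 (phi (a 0))).
      by rewrite a0; exact: (dmu_differentiable _ (@mul_dom0 R n G)).
    have := is_derive_comp (is_derive_row_mx cx al) dj => ?; exact: ex_derive.
  have E : dmu (row_mx x0 (phi (a 0))) (inl_mx (delta_mx 0 j)) = delta_mx 0 j.
    by rewrite a0; exact: dmu_inl.
  exact: (eq_ind _ (fun u => _ --> u) Hc _ E).
have adom : \forall s \near (0 : R), dom (a s).
  by apply: chart_dom_near av.1 _; rewrite a0; exact: dom1.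
have /nbhs_normP[d1 /= d10 H1] :
    \forall s \near (0 : R), (forall u, `|u| <= 2 * `|L s u|) /\ dom (a s).
  exact: filterI Lnear adom.
apply: eps_is_derive => e e0.
have [d2 d20 H2] := diff_eps Dd (divr_gt0 e0 (ltr0Sn R 1)).
exists (Num.min d1 d2); first by rewrite lt_min d10.
move=> k; rewrite lt_min => /andP[k1 k2].
have [Lk ak] : (forall u, `|u| <= 2 * `|L k u|) /\ dom (a k).
  by apply: H1; rewrite /= sub0r normrN.
rewrite add0r scaler0 subr0 a0 Ad1.
apply: le_trans (Lk _) _.
have -> : L k (Ad (a k) w - w) = (P - Q) (0 + k) - (P - Q) 0 - 'd (P - Q) (0 : R) k.
  rewrite D0 subr0 add0r.
  have -> : (P - Q) 0 = 0 by rewrite !fctE PQ0 subrr.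
  by rewrite subr0 linearB/= Ad_in_chart.
have := H2 k k2; lra.
Qed.

Section ExpCommute.
Context (X Y : vfield G) (Xi : translation_invariant X) (Yi : translation_invariant Y).
Context (XY0 : hess (X 1%g) (Y 1%g) = hess (Y 1%g) (X 1%g)).

(** By the homomorphism property, the derivative of [s |-> Ad (exp (s X)) Y] at
    [t] is the image under [Ad (exp (t X))] of its derivative at 0. *)
Lemma Ad_exp_curve s : Ad (exp_curve X s) (Y 1%g) = Y 1%g.
Proof.
pose V s := Ad (exp_curve X s) (Y 1%g).
have V0 (t : R) : is_derive t (1 : R) V 0.
  have D0 : is_derive (0 : R) (1 : R) V 0.
    apply: Ad_velocity0 XY0; first exact: exp_curve0.
    by have := exp_curve_velocity Xi 0; rewrite exp_curve0.
  have := Ad_is_derive (exp_curve X t) D0.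
  have -> : Ad (exp_curve X t) 0 = 0 by rewrite /Ad !tangent_map0.
  have -> : (fun r => Ad (exp_curve X t) (V r)) = fun r => V (r + t).
    by apply/funext => r; rewrite /V addrC exp_curveD// AdM.
  exact: is_derive_translate.
have key (p q : R) : p <= q -> V q = V p.
  move=> pq; apply/eqP; rewrite -subr_eq0 -normr_le0.
  have : `|V q - V p - (q - p) *: 0| <= 0 * (q - p).
    apply: (@mean_value_le R n V (fun=> 0)) => // r _.
    by rewrite subrr normr0.
  by rewrite scaler0 subr0 mul0r.
have V00 : V 0 = Y 1%g by rewrite /V exp_curve0// Ad1.
rewrite -/(V s) -V00; case: (leP 0 s) => [s0|/ltW s0]; first exact: key.
by apply/esym; exact: key.
Qed.

(** The conjugate of [exp (t Y)] by [exp (s X)] is a homomorphism with the same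
    initial velocity. *)
Lemma exp_curve_commute s t :
  (exp_curve X s * exp_curve Y t = exp_curve Y t * exp_curve X s)%g.
Proof.
set g := exp_curve X s.
have E : exp_curve Y = (fun t => g * exp_curve Y t * g^-1)%g.
  apply: (integral_curve_unique Yi); last by rewrite exp_curve0// mulg1 mulgV.
    exact: exp_curve_velocity.
  apply: hom_integral_curve => // [p q|].
    by rewrite exp_curveD// !mulgA -[(_ * g^-1 * g)%g]mulgA mulVg mulg1.
  rewrite -(Ad_exp_curve s); apply: has_velocity_conj; first exact: exp_curve0.
  by have := exp_curve_velocity Yi 0; rewrite exp_curve0.
by rewrite [in RHS]E -mulgA mulVg mulg1.
Qed.

End ExpCommute.
End Commutation.

(** * Piecewise constant controls and concatenation *)

Section Pieces.
Context {R : realType} {m : nat}.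
Implicit Types (u : R -> 'rV[R]_m) (s : seq R) (t : R).

(** Piecewise constancy by recursion on the subdivision, which is more convenient
    for induction and concatenation than the indexed form. *)
Fixpoint pieces u t s : Prop :=
  if s is t' :: s' then
    [/\ t < t', (exists v, forall r, t < r < t' -> u r = v) & pieces u t' s']
  else True.

Lemma piecesP u t s : pieces u t s <->
  path <%R t s /\ (forall i, (i < size s)%N -> exists v,
     forall r, nth 0 (t :: s) i < r < nth 0 s i -> u r = v).
Proof.
elim: s t => [|t' s IH] t; first by split.
split=> [[tt' H0 /IH[ps H]]|[/= /andP[tt' ps] H]].
  by split=> [|[|i] Hi //=]; [rewrite /= tt'|exact: (H i Hi)].
split=> //; first exact: (H 0%N).
by apply/IH; split => // i Hi; exact: (H i.+1).
Qed.

Lemma piecewise_constantP (T : R) u :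
  piecewise_constant T u <-> exists2 s, pieces u 0 s & last 0 s = T.
Proof.
split=> [[s /andP[ps /eqP sT] H]|[s /piecesP[ps H] sT]].
  by exists s => //; apply/piecesP.
by exists s; rewrite ?ps ?sT ?eqxx.
Qed.

Lemma pieces_last u t s : pieces u t s -> t <= last t s.
Proof.
by elim: s t => [|t' s IH] t //= [/ltW tt' _ /IH]; exact: le_trans.
Qed.

Lemma pieces_cat u t s1 s2 :
  pieces u t s1 -> pieces u (last t s1) s2 -> pieces u t (s1 ++ s2).
Proof.
elim: s1 t => [|t' s IH] t //= [tt' H ps] ps2; split => //.
exact: IH.
Qed.

Lemma pieces_eq u u' t s : (forall r, t < r < last t s -> u r = u' r) ->
  pieces u t s -> pieces u' t s.
Proof.
elim: s t => [|t' s IH] t //= uu [tt' [v Hv] ps]; split => //.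
  exists v => r /andP[tr rt']; rewrite -uu ?Hv ?tr//.
  by rewrite (lt_le_trans rt')// (pieces_last ps).
by apply: IH ps => r /andP[tr rt]; apply: uu; rewrite (lt_trans tt' tr).
Qed.

Lemma pieces_shift u t s (T : R) : pieces u t s ->
  pieces (fun r => u (r - T)) (t + T) (map (fun r => r + T) s).
Proof.
elim: s t => [|t' s IH] t //= [tt' [v Hv] ps]; split; last exact: IH.
  by rewrite ltrD2r.
by exists v => r /andP[a b]; apply: Hv; rewrite ltrBrDr a ltrBlDr.
Qed.

Lemma last_shift t s (T : R) : last (t + T) (map (fun r => r + T) s) = last t s + T.
Proof. by elim: s t => //= t' s IH t. Qed.

End Pieces.

Section Concatenation.
Context {R : realType} {n m : nat} {M : smoothManifoldType R n}.
Context (F : 'rV[R]_m -> vfield M) (U : set 'rV[R]_m).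

(** The second trajectory is shifted in time and glued to the first one; the
    junction joins the exceptional times. *)
Lemma reachable_trans p q r :
  reachable F U p q -> reachable F U q r -> reachable F U p r.
Proof.
move=> [T1 /= T10 [u1 [c1 [[/piecewise_constantP[s1 ps1 l1] U1] [cc1 [e1 v1]] c10 c1T]]]].
move=> [T2 /= T20 [u2 [c2 [[/piecewise_constantP[s2 ps2 l2] U2] [cc2 [e2 v2]] c20 c2T]]]].
exists (T1 + T2); first by rewrite /= addr_gt0.
pose u t := if t < T1 then u1 t else u2 (t - T1).
pose c t := if t <= T1 then c1 t else c2 (t - T1).
exists u, c; split; first split.
- apply/piecewise_constantP; exists (s1 ++ map (fun r => r + T1) s2).
    apply: pieces_cat.
      by apply: pieces_eq ps1 => t; rewrite l1 /u => /andP[_ ->].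
    rewrite l1 -[X in pieces _ X]add0r.
    apply: pieces_eq (pieces_shift T1 ps2) => t; rewrite last_shift l2 add0r.
    by rewrite /u => /andP[/ltW]; rewrite leNgt => /negbTE ->.
  by rewrite last_cat l1 -[X in last X]add0r last_shift l2 addrC.
- move=> t /andP[t0 tT]; rewrite /u; case: ltP => tT1.
    by apply: U1; rewrite t0 ltW.
  by apply: U2; rewrite subr_ge0 tT1 lerBlDl.
- split; last first.
    exists (T1 :: e1 ++ map (fun r => r + T1) e2) => t /andP[t0 tT].
    rewrite inE negb_or mem_cat negb_or => /and3P[tT1 te1 te2].
    have [lt|gt|E] := ltgtP t T1; last by rewrite E eqxx in tT1.
      have := v1 t (ltac:(by rewrite t0 lt)) te1.
      rewrite /u /c lt (ltW lt); apply: has_velocity_near.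
      near=> x; have -> // : x <= T1; rewrite ltW//; near: x; exact: lt_nbhsl.
    have te2' : t - T1 \notin e2.
      by apply: contra te2 => H; apply/mapP; exists (t - T1); rewrite ?subrK.
    have := v2 (t - T1) (ltac:(by rewrite subr_gt0 gt ltrBlDl)) te2'.
    have -> : u t = u2 (t - T1) by rewrite /u ltNge ltW.
    have -> : c t = c2 (t - T1) by rewrite /c leNgt gt.
    have E : t - T1 = 1 * t + - T1 by rewrite mul1r.
    rewrite E => /has_velocity_reparam; rewrite scale1r; apply: has_velocity_near.
    near=> x; rewrite /c leNgt; have -> : T1 < x by near: x; exact: lt_nbhsr.
    by rewrite mul1r.
  have -> : (`[0, T1 + T2] = `[0, T1] `|` `[T1, T1 + T2])%classic.
    apply/seteqP; split => t /=; rewrite !in_itv /=.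
      by move=> /andP[t0 tT]; case: (leP t T1) => H; [left|right];
        rewrite /= ?in_itv /= ?t0 ?tT ?H ?(ltW H).
    move=> [/andP[t0 tT]|/andP[t0 ->]]; last by rewrite (le_trans _ t0)// ltW.
    by rewrite t0 (le_trans tT)// lerDl ltW.
  apply: withinU_continuous; [exact: itv_closed|exact: itv_closed| |].
    apply: subspace_eq_continuous cc1 => t; rewrite inE /= in_itv /= => /andP[_ tT].
    by change (c1 t = if t <= T1 then c1 t else c2 (t - T1)); rewrite ifT.
  have c1c2 : c1 T1 = c2 0 by rewrite c1T.
  apply: (@subspace_eq_continuous _ _ _ (fun t => c2 (t - T1))) => [t|].
    rewrite inE /= in_itv /= => /andP[tT _].
    change (c2 (t - T1) = if t <= T1 then c1 t else c2 (t - T1)).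
    case: ifP => // tT'.
    have -> : t = T1 by apply/eqP; rewrite eq_le tT tT'.
    by rewrite subrr c1c2.
  apply/subspace_continuousP => t; rewrite /= in_itv /= => /andP[tT tT'].
  have tB : `[0, T2]%classic (t - T1) by rewrite /= in_itv /= subr_ge0 tT lerBlDl.
  move/subspace_continuousP : cc2 => /(_ _ tB) cc2 W /cc2 HW.
  have sh : (fun x => x - T1) @ t --> t - T1 by apply: cvgB; [exact: cvg_id|exact: cvg_cst].
  have K : nbhs t [set x | `[0, T2]%classic (x - T1) -> W (c2 (x - T1))] := sh _ HW.
  change (nbhs t [set x | `[T1, T1 + T2]%classic x -> W (c2 (x - T1))]).
  move: K; apply: filterS => x /= H; rewrite in_itv/= => /andP[xa xb]; apply: H.
  by rewrite in_itv/= subr_ge0 xa lerBlDl.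
- by rewrite /c ltW.
- by rewrite /c gerDl leNgt T20/= addrAC subrr add0r.
Unshelve. all: by end_near. Qed.

End Concatenation.

(** * From the invariant to the affine system *)

Section DI.
Context {R : realType} {n : nat} {G : lieGroupType R n}.
Implicit Types (g p x : G) (c d : R -> G) (t : R) (X Z : vfield G).

(** This curve is the inverse of the translated curve [c p^-1]. *)
Lemma has_velocity_dI X c t p : translation_invariant X ->
  has_velocity c t (X (c t)) ->
  has_velocity (fun s => (p * (c s)^-1)%g) t (dI X (p * (c t)^-1)%g).
Proof.
move=> Xi cv; have := has_velocity_inv (translate_curve (p^-1)%g Xi cv).
have E q : ((q * p^-1)^-1 = p * q^-1)%g by rewrite invgM invgK.
have -> : (fun s => (c s * p^-1)^-1%g) = (fun s => (p * (c s)^-1)%g) by apply/funext.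
by rewrite /dI invgM invgK.
Qed.

(** Right translation by an element that commutes with [exp (t X)] preserves the
    curves [g exp (- t X)], which are the integral curves of [dI X]. *)
Lemma dI_mulr X g x : translation_invariant X ->
  (forall t, (exp_curve X t * x = x * exp_curve X t)%g) ->
  dI X (g * x)%g = tangent_map (fun h => (h * x)%g) g (dI X g).
Proof.
move=> Xi Xx.
have V p : has_velocity (fun s => (p * (exp_curve X s)^-1)%g) 0 (dI X p).
  have := has_velocity_dI p Xi (exp_curve_velocity Xi 0).
  by rewrite exp_curve0// invg1 mulg1.
have := has_velocity_mulr x (V g); rewrite exp_curve0// invg1 mulg1.
have -> : (fun s => (g * (exp_curve X s)^-1 * x)%g) = (fun s => (g * x * (exp_curve X s)^-1)%g).
  apply/funext => s; rewrite -!mulgA; congr (g * _)%g.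
  by apply: (mulgI (exp_curve X s)); rewrite !mulgA mulgV mul1g Xx -mulgA mulgV mulg1.
exact: has_velocity_unique (V (g * x)%g).
Qed.

(** The left factor contributes [Z], the right one [dI X]. *)
Lemma has_velocity_sandwich X Z c d t p :
  translation_invariant Z -> translation_invariant X ->
  has_velocity c t (Z (c t)) -> has_velocity d t (X (d t)) ->
  has_velocity (fun s => (c s * (p * (d s)^-1))%g) t
    (Z (c t * (p * (d t)^-1))%g + dI X (c t * (p * (d t)^-1))%g).
Proof.
move=> Zi Xi cv dv; have pd := has_velocity_dI p Xi dv.
have := has_velocity_mul cv pd; congr has_velocity; congr (_ + _); first exact/esym/Zi.
apply: (has_velocity_unique (has_velocity_mull (c t) pd)).
have := has_velocity_dI (c t * p)%g Xi dv; rewrite -mulgA.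
congr has_velocity; apply/funext => s; by rewrite mulgA.
Qed.

End DI.

Section AffineComb.
Context {R : realType} {n m : nat} {G : lieGroupType R n}.
Implicit Types (A B : 'I_m.+1 -> vfield G) (u : 'rV[R]_m).

Lemma affine_comb_invariant A u : (forall i, translation_invariant (A i)) ->
  translation_invariant (affine_comb A u).
Proof.
move=> Ai a g; rewrite /affine_comb Ai /tangent_map linearD linear_sum.
congr (_ + _); apply: eq_bigr => j _; rewrite linearZ/=; congr (_ *: _).
exact: Ai.
Qed.

Lemma affine_combD A B u g : affine_comb (fun i g => A i g + B i g) u g =
  affine_comb A u g + affine_comb B u g.
Proof.
rewrite /affine_comb addrACA; congr (_ + _); rewrite -big_split.
by apply: eq_bigr => j _; rewrite scalerDr.
Qed.

Lemma affine_comb_dI A u g : affine_comb (fun i => dI (A i)) u g = dI (affine_comb A u) g.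
Proof.
rewrite /affine_comb /dI /tangent_map linearD linear_sum; congr (_ + _).
by apply: eq_bigr => j _; rewrite linearZ.
Qed.

(** The vectors [a] with [hess a w = hess w a] form a subspace. *)
Lemma affine_comb_hess A u (w : 'rV[R]_n) :
  (forall i, hess (G := G) (A i 1%g) w = hess (G := G) w (A i 1%g)) ->
  hess (G := G) (affine_comb A u 1%g) w = hess (G := G) w (affine_comb A u 1%g).
Proof.
move=> Aw; pose P a := hess (G := G) a w = hess (G := G) w a.
have Pl k a b : P a -> P b -> P (k *: a + b).
  by move=> Pa Pb; rewrite /P (hess_linear_l w k a b) (hess_linear_r w k a b) Pa Pb.
(* [0 = - a + a] for any [a] in the subspace. *)
have P0 : P 0.
  have := Pl (-1) _ _ (Aw ord0) (Aw ord0).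
  by rewrite scaleN1r addNr.
rewrite -/(P _) /affine_comb -[A ord0 1%g]scale1r; apply: (Pl 1); first exact: Aw.
apply: (big_ind P) => // [a b Pa Pb|j _]; first by rewrite -[a]scale1r; exact: Pl.
by rewrite -[X in P X]addr0; apply: Pl.
Qed.

End AffineComb.

Section Transfer.
Context {R : realType} {n m : nat} {G : lieGroupType R n}.
Context (X Y : 'I_m.+1 -> vfield G) (U : set 'rV[R]_m).
Context (Xi : forall i, translation_invariant (X i)).
Context (Yi : forall i, translation_invariant (Y i)).

Local Notation Xu := (affine_comb X).
Local Notation SI := (affine_comb (fun i g => X i g + Y i g)).
Local Notation ex u := (exp_curve (Xu u)).

Let Xui u : translation_invariant (Xu u) := affine_comb_invariant u Xi.

Let SIi u : translation_invariant (SI u).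
Proof.
apply: affine_comb_invariant => i a g.
by rewrite Xi Yi /tangent_map -linearD.
Qed.

(** The set of products of exponentials [exp (t X_u)] with [u] in [U].  Each
    step of a piecewise constant control multiplies by one such factor. *)
Inductive exp_products : G -> Prop :=
| exp_products1 : exp_products 1%g
| exp_productsM x u t : exp_products x -> U u -> exp_products (x * ex u t)%g.

(** The solution on each piece is multiplied on the right by the value reached
    at the beginning of that piece.  Each factor is frozen outside its own piece by
    clipping the time, so that the product is continuous on the whole line. *)
Lemma steering_curve (u : R -> 'rV[R]_m) s t0 : pieces u t0 s ->
  (forall t, t0 <= t <= last t0 s -> U (u t)) ->
  exists k : R -> G, [/\ continuous k, forall t, t <= t0 -> k t = 1%g,
    forall t, exp_products (k t) &
    forall t, t0 < t < last t0 s -> t \notin s -> has_velocity k t (Xu (u t) (k t))].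
Proof.
elim: s t0 => [|t1 s IH] t0 /=.
  move=> _ _; exists (fun=> 1%g); split => //.
  - by move=> t; exact: cst_continuous.
  - by move=> t; exact: exp_products1.
  - by move=> t /andP[a b]; have := lt_trans a b; rewrite ltxx.
move=> [t01 [v Hv] ps] Us.
have t1s := pieces_last ps.
have [|k [kc k1 kE kv]] := IH t1 ps.
  by move=> t /andP[a b]; apply: Us; rewrite b (le_trans (ltW t01)).
have Uv : U v.
  (* The value [v] is taken at the midpoint, where the control is in [U]. *)
  have mid : t0 < (t0 + t1) / 2 < t1 by apply/andP; split; lra.
  rewrite -(Hv _ mid); apply: Us; move/andP : mid => [a b].
  by rewrite ltW//= (le_trans (ltW b)).
(* The time spent in the first piece [[t0, t1]] up to [t]. *)
pose r t := Num.max 0 (Num.min (t - t0) (t1 - t0)).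
have rc : continuous r.
  move=> t.
  have lc : {for t, continuous (fun t : R => t - t0 : R^o)}.
    by apply: cvgB; [exact: cvg_id|exact: cvg_cst].
  have c0 (a : R) : {for t, continuous (fun=> a : R^o)} by exact: cst_continuous.
  exact: (continuous_max (c0 0) (continuous_min lc (c0 (t1 - t0)))).
pose e t := ex v (r t).
have ec : continuous e.
  move=> t; apply: continuous_comp; first exact: rc.
  by have [] := exp_curve_velocity (Xui v) (r t).
exists (fun t => k t * e t)%g; split.
- by move=> t; apply: mulg_continuous; [exact: kc|exact: ec].
- move=> t tt0; rewrite k1 ?(le_trans tt0 (ltW t01))// /e /r mul1g.
  have -> : Num.max 0 (Num.min (t - t0) (t1 - t0)) = 0.
    by apply/max_idPl; rewrite ge_min subr_le0 tt0.
  exact: exp_curve0.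
- by move=> t; apply: exp_productsM.
move=> t /andP[a b]; rewrite inE negb_or => /andP[tt1 ts].
have [lt|gt|E] := ltgtP t t1; last by rewrite E eqxx in tt1.
  have rE x : t0 < x < t1 -> (k x * e x)%g = ex v (1 * x + - t0).
    move=> /andP[x0 x1]; rewrite k1 ?(ltW x1)// mul1g mul1r /e /r; congr (ex v _).
    rewrite min_l ?lerD2r ?(ltW x1)//.
    by apply/max_idPr; rewrite subr_ge0 ltW.
  rewrite (Hv t) ?a// rE ?a//.
  have := has_velocity_reparam (c := ex v) (k := 1) (b := - t0) (t := t)
    (exp_curve_velocity (Xui v) _).
  rewrite scale1r; apply: has_velocity_near; near=> x; rewrite rE//.
  by apply/andP; split; near: x; [exact: lt_nbhsr|exact: lt_nbhsl].
have rE x : t1 < x -> (k x * e x)%g = (k x * ex v (t1 - t0))%g.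
  move=> x1; congr (_ * _)%g; rewrite /e /r; congr (ex v _).
  rewrite min_r ?lerD2r ?(ltW x1)//.
  by apply/max_idPr; rewrite subr_ge0 ltW.
rewrite (rE t)//.
have := translate_curve (ex v (t1 - t0)) (Xui (u t)) (kv t (ltac:(by rewrite gt)) ts).
by apply: has_velocity_near; near=> x; rewrite rE//; near: x; exact: lt_nbhsr.
Unshelve. all: by end_near. Qed.

Context (LX : 'I_m.+1 -> vfield G).
Context (LX_X : forall i g, LX i g = X i g + dI (X i) g).

Local Notation SA := (affine_comb (fun i g => LX i g + Y i g)).

Lemma SA_E u g : SA u g = SI u g + dI (Xu u) g.
Proof.
rewrite -affine_comb_dI -affine_combD /affine_comb.
congr (_ + _); first by rewrite LX_X addrAC.
by apply: eq_bigr => j _; rewrite LX_X addrAC.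
Qed.

(** The trajectory [c p k^-1], where [c] is the given one and [k] is the steering
    curve of the same control. *)
Lemma reachable_transfer h : reachable SI U 1%g h ->
  exists2 e, exp_products e & forall p, reachable SA U p (h * (p * e^-1))%g.
Proof.
move=> [T T0 [u [c [[/piecewise_constantP[s ps sT] Us] [cc [l cv]] c0 cT]]]].
have [|k [kc k1 kE kv]] := steering_curve ps; first by rewrite sT.
exists (k T) => // p; exists T => //; exists u, (fun t => c t * (p * (k t)^-1))%g.
split.
- by split => //; apply/piecewise_constantP; exists s.
- split.
    apply/subspace_continuousP => t tT.
    apply: (@continuous2_cvg _ _ _ _ _ _ c (fun t => p * (k t)^-1)%g (fun x y => x * y)%g).
    + by have H := (@mulg_smooth R n G).1 (c t, (p * (k t)^-1)%g); exact: H.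
    + by move/subspace_continuousP : cc; apply.
    + have dc : {for t, continuous (fun t => p * (k t)^-1)%g}.
        apply: mulg_continuous; first exact: cst_continuous.
        by apply: continuous_comp; [exact: kc|exact: (@invg_smooth R n G).1].
      by apply: (cvg_trans _ dc); apply: cvg_fmap2; exact: cvg_within.
  exists (l ++ s) => t t0T; rewrite mem_cat negb_or => /andP[tl ts].
  rewrite SA_E; apply: has_velocity_sandwich => //.
    exact: cv.
  by apply: kv => //; rewrite sT.
- by rewrite c0 k1// invg1 mulg1 mul1g.
- by rewrite cT.
Qed.

Lemma reachable_mulr p q x : (forall u t, U u -> (ex u t * x = x * ex u t)%g) ->
  reachable SA U p q -> reachable SA U (p * x)%g (q * x)%g.
Proof.
move=> xc [T T0 [u [c [[pu Us] [cc [l cv]] c0 cT]]]].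
exists T => //; exists u, (fun t => c t * x)%g; split => //.
- split.
    apply/subspace_continuousP => t tT.
    apply: (@continuous2_cvg _ _ _ _ _ _ c (fun=> x) (fun x y => x * y)%g).
    + by have H := (@mulg_smooth R n G).1 (c t, x); exact: H.
    + by move/subspace_continuousP : cc; apply.
    + exact: cvg_cst.
  exists l => t t0T tl; have := has_velocity_mulr x (cv t t0T tl).
  congr has_velocity; rewrite !SA_E /tangent_map linearD; congr (_ + _).
    exact/esym/SIi.
  apply/esym; apply: dI_mulr => // r; apply: xc; apply: Us.
  by move/andP: t0T => [a b]; rewrite !ltW.
- by rewrite c0.
- by rewrite cT.
Qed.

Context (X_comm : forall u v s t, (ex u s * ex v t = ex v t * ex u s)%g).

Lemma exp_products_commute x u t : exp_products x -> (ex u t * x = x * ex u t)%g.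
Proof.
elim=> [|y v s _ IH _]; first by rewrite mul1g mulg1.
by rewrite mulgA IH -!mulgA X_comm.
Qed.

(** Translating the trajectory from [1] to [exp (t X_u)] by [y] prolongs one
    that ends at [y]. *)
Lemma exp_products_reachable : U !=set0 ->
  (forall u t, U u -> reachable SA U 1%g (ex u t)) ->
  forall x, exp_products x -> reachable SA U 1%g x.
Proof.
move=> [u0 Uu0] H x; elim=> [|y u t _ yr Uu].
  by have := H u0 0 Uu0; rewrite exp_curve0.
apply: reachable_trans (H u t Uu) _.
rewrite -[X in reachable _ _ X]mul1g; exact: reachable_mulr.
Qed.

(** The path is p, e1^-1, 1, e2, q, where [e1] and [e2] are the elements attached
    by [reachable_transfer] to [p^-1] and to [q]. *)
Lemma controllable_of_exp : controllable SI U ->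
  (forall u t, U u -> reachable SA U 1%g (ex u t)) -> controllable SA U.
Proof.
move=> SIc H.
have SI1 h : reachable SI U 1%g h by rewrite SIc.
have U0 : U !=set0.
  have [T T0 [u [c [[_ Us] _ _ _]]]] := SI1 1%g.
  by exists (u 0); apply: Us; rewrite lexx ltW.
have Er := exp_products_reachable U0 H.
move=> p; apply/seteqP; split => // q _.
have [e1 E1 r1] := reachable_transfer (SI1 p^-1%g).
have [e2 E2 r2] := reachable_transfer (SI1 q).
have p_e1 : reachable SA U p (e1^-1)%g.
  by have := r1 p; rewrite mulgA mulVg mul1g.
have e1_1 : reachable SA U (e1^-1)%g 1%g.
  have := reachable_mulr (x := (e1^-1)%g) _ (Er _ E1); rewrite mul1g mulgV; apply.
  move=> u t _; apply: (mulgI e1); apply: (mulIg e1).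
  by rewrite -!mulgA mulVg mulg1 !mulgA mulgV mul1g exp_products_commute.
have e2_q : reachable SA U e2 q by have := r2 e2; rewrite mulgV mulg1.
apply: reachable_trans p_e1 _; apply: reachable_trans e1_1 _.
exact: reachable_trans (Er _ E2) e2_q.
Qed.

End Transfer.

Unset Implicit Arguments.

Theorem theorem3p3 (R : realType) (n m : nat) (G : lieGroupType R n)
    (G_connected : connected [set: G])
    (LX X Y : 'I_m.+1 -> vfield G)
    (U : set 'rV[R]_m)
    (LX_linear : forall i, linear_vfield (LX i))
    (LX_commute : forall i j g, lie_bracket (LX i) (LX j) g = 0)
    (LX_inner : forall i, inner_derivation (associated_derivation (LX i)))
    (X_inv : forall i, right_invariant (X i))
    (LX_X : forall i g, LX i g = X i g + dI (X i) g)
    (X_commute : forall i j g, lie_bracket (X i) (X j) g = 0)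
    (Y_inv : forall i, right_invariant (Y i))
    (SigmaI_controllable :
       controllable (affine_comb (fun i g => X i g + Y i g)) U) :
  let SigmaA := affine_comb (fun i g => LX i g + Y i g) in
  (forall (u : 'rV[R]_m) (t : R), U u ->
     reachable SigmaA U (1%g : G) (lie_exp (fun g => t *: affine_comb X u g)))
  <-> controllable SigmaA U.
Proof.
move=> SigmaA.
have Xi i : translation_invariant (X i) := (X_inv i).2.
have Yi i : translation_invariant (Y i) := (Y_inv i).2.
have Xui u := affine_comb_invariant u Xi.
split=> [H|H u t _]; last by rewrite H.
apply: (controllable_of_exp Xi Yi LX_X) => // [u v s t|u t Uu].
  apply: exp_curve_commute => //; apply: affine_comb_hess => i.
  apply/esym; apply: affine_comb_hess => j.
  have := X_commute i j 1%g; rewrite lie_bracket1//.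
  by move/eqP; rewrite subr_eq0 => /eqP.
by have := H u t Uu; rewrite lie_exp_scale.
Qed.
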